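(* Let $C>\frac{4}{3^{3/2}}$ and $C^\ast\in\left(0,\left(C-\frac{4}{3^{3/2}}\right)^{-1/2}\right)$. The universal cover of the surface of revolution in $\mathbb{R}^3$ given by $$\Psi_{C,C^\ast}(h,\theta)=\left(\frac{C^\ast}{F(h)}\cos\frac{\theta}{C^\ast},\ \frac{C^\ast}{F(h)}\sin\frac{\theta}{C^\ast},\ h\right),\qquad (h,\theta)\in\mathbb{R}^2,$$ where $F$ is the function (depending on $C$ and $C^\ast$) defined in the context, is $\mathbb{R}^2$ endowed with the metric $g_{C,C^\ast}$. It is complete, its Gaussian curvature $K$ satisfies $1-K>0$ on $\mathbb{R}^2$ and, on an open dense subset, it is locally isometric to $(D_C,g_C)$ and $\operatorname{grad}K\neq0$ at any point of that subset. Moreover, for any $C_1^\ast,C_2^\ast\in\left(0,\left(C-\frac{4}{3^{3/2}}\right)^{-1/2}\right)$, the surfaces $(\mathbb{R}^2,g_{C,C_1^\ast})$ and $(\mathbb{R}^2,g_{C,C_2^\ast})$ are isometric.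
   Context: For $C>\frac{4}{3^{3/2}}$ the function $T(\xi)=-\xi^{8/3}+3C\xi^2-3$, $\xi>0$, has exactly two positive zeros $0<\xi_{01}<\xi_{02}$ and is positive on $(\xi_{01},\xi_{02})$. $D_C=(\xi_{01},\xi_{02})\times\mathbb{R}$, with coordinates $(\xi,\theta)$, carries the Riemannian metric $$g_C=\frac{3}{\xi^2(-\xi^{8/3}+3C\xi^2-3)}\,d\xi^2+\frac{1}{\xi^2}\,d\theta^2 .$$ The function $F$. Put $\xi_{00}=\left(\frac94C\right)^{3/2}\in(\xi_{01},\xi_{02})$ and, for $\xi\in(\xi_{01},\xi_{02})$, $$h_0(\xi)=\int_{\xi_{00}}^{\xi}\sqrt{\frac{3\tau^2-(C^\ast)^2T(\tau)}{\tau^4T(\tau)}}\,d\tau .$$ This is strictly increasing with finite limits $h_{0,-1}=\lim_{\xi\searrow\xi_{01}}h_0(\xi)$ and $h_{0,1}=\lim_{\xi\nearrow\xi_{02}}h_0(\xi)$. For $k\in\mathbb{Z}\setminus\{0\}$ put $$h_{0,k}=\begin{cases}k\,h_{0,1}-(k-1)h_{0,-1},&k\ge1,\\ -k\,h_{0,-1}+(k+1)h_{0,1},&k\le-1,\end{cases}$$ and for $k\in\mathbb{Z}$ and $\xi\in(\xi_{01},\xi_{02})$ put $$h_k(\xi)=\begin{cases}k(h_{0,1}-h_{0,-1})+h_0(\xi),&k\text{ even},\\ (k+1)h_{0,1}-(k-1)h_{0,-1}-h_0(\xi),&k\text{ odd}.\end{cases}$$ Then $h_k$ is a diffeomorphism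 from $(\xi_{01},\xi_{02})$ onto $(h_{0,k},h_{0,k+1})$ if $k\ge1$, onto $(h_{0,-1},h_{0,1})$ if $k=0$, and onto $(h_{0,k-1},h_{0,k})$ if $k\le-1$; let $\xi_k=\xi_k(h)$ denote its inverse. Define $F:\mathbb{R}\to\mathbb{R}$ by $F(h)=\xi_k(h)$ on each of these open intervals, and at their endpoints by: for $k\ge1$, $F(h_{0,k})=\xi_{02}$ if $k$ is odd and $\xi_{01}$ if $k$ is even; for $k\le-1$, $F(h_{0,k})=\xi_{01}$ if $k$ is odd and $\xi_{02}$ if $k$ is even. $F$ is at least of class $C^3$. The metric. On $\mathbb{R}^2$ with coordinates $(h,\theta)$, $$g_{C,C^\ast}(h,\theta)=\frac{3F^2(h)}{3F^2(h)-(C^\ast)^2\left(-F^{8/3}(h)+3CF^2(h)-3\right)}dh^2+\frac{1}{F^2(h)}d\theta^2 .$$ The surface of revolution carries the metric induced from $\mathbb{R}^3$, and ''universal cover'' is understood in the Riemannian sense (the covering map is a local isometry). *)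

(* Defs.v *)
From Stdlib Require Import Reals ZArith.
From Coquelicot Require Import Coquelicot.

Open Scope R_scope.

Inductive axis : Set := ax1 | ax2.

Definition vec (i : axis) : R * R :=
  match i with ax1 => (1, 0) | ax2 => (0, 1) end.

Definition sum_axes (f : axis -> R) : R := f ax1 + f ax2.

(** [along i p f] is the restriction of [f] to the line through [p] in
    direction [i], parametrized by the [i]-th coordinate. *)
Definition along (i : axis) (p : R * R) (f : R * R -> R) : R -> R :=
  match i with
  | ax1 => fun t => f (t, snd p)
  | ax2 => fun t => f (fst p, t)
  end.

Definition coord (i : axis) (p : R * R) : R :=
  match i with ax1 => fst p | ax2 => snd p end.

Definition partial (i : axis) (f : R * R -> R) (p : R * R) : R :=
  Derive (along i p f) (coord i p).

(** [f] is of class [C^n] on the open set [D]. *)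
Fixpoint class_C (n : nat) (D : R * R -> Prop) (f : R * R -> R) : Prop :=
  match n with
  | O => forall p, D p -> continuous f p
  | S m =>
      (forall i p, D p -> ex_derive (along i p f) (coord i p)) /\
      (forall i, class_C m D (partial i f))
  end.

Definition class_C_map (n : nat) (D : R * R -> Prop) (phi : R * R -> R * R) : Prop :=
  forall i, class_C n D (fun p => coord i (phi p)).

Definition diff (f : R * R -> R) (p u : R * R) : R :=
  sum_axes (fun i => partial i f p * coord i u).

Definition diff_map (phi : R * R -> R * R) (p u : R * R) : R * R :=
  (diff (fun q => fst (phi q)) p u, diff (fun q => snd (phi q)) p u).

Definition plane : R * R -> Prop := fun _ => True.

(** [g p u v] is the value at [p] of the metric on the tangent vectors [u], [v]. *)
Definition metric : Type := R * R -> R * R -> R * R -> R.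

Definition gcoef (g : metric) (i j : axis) (p : R * R) : R := g p (vec i) (vec j).

(** The metric [a dx^2 + b dy^2]. *)
Definition diag_metric (a b : R * R -> R) : metric :=
  fun p u v => a p * (fst u * fst v) + b p * (snd u * snd v).

(** All regularity requirements below are of class [C^3]. *)
Definition riemannian_metric (D : R * R -> Prop) (g : metric) : Prop :=
  (forall p u v, D p -> g p u v = g p v u) /\
  (forall p (a : R) (u v w : R * R), D p ->
     g p (plus (scal a u) v) w = a * g p u w + g p v w) /\
  (forall p u, D p -> u <> (0, 0) -> 0 < g p u u) /\
  (forall i j, class_C 3 D (gcoef g i j)).

Definition gdet (g : metric) (p : R * R) : R :=
  gcoef g ax1 ax1 p * gcoef g ax2 ax2 p - gcoef g ax1 ax2 p * gcoef g ax2 ax1 p.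

Definition ginv (g : metric) (i j : axis) (p : R * R) : R :=
  match i, j with
  | ax1, ax1 => gcoef g ax2 ax2 p / gdet g p
  | ax2, ax2 => gcoef g ax1 ax1 p / gdet g p
  | ax1, ax2 => - gcoef g ax1 ax2 p / gdet g p
  | ax2, ax1 => - gcoef g ax2 ax1 p / gdet g p
  end.

(** Christoffel symbols [Gamma^k_{ij}] of the Levi-Civita connection. *)
Definition christoffel (g : metric) (k i j : axis) (p : R * R) : R :=
  sum_axes (fun l =>
    / 2 * ginv g k l p *
    (partial i (gcoef g j l) p + partial j (gcoef g i l) p - partial l (gcoef g i j) p)).

(** [l]-th component of [R(d_i, d_j) d_k = nabla_i nabla_j d_k - nabla_j nabla_i d_k]. *)
Definition riemann (g : metric) (l i j k : axis) (p : R * R) : R :=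
  partial i (christoffel g l j k) p - partial j (christoffel g l i k) p
  + sum_axes (fun m => christoffel g m j k p * christoffel g l i m p
                       - christoffel g m i k p * christoffel g l j m p).

(** [K = g(R(d_1, d_2) d_2, d_1) / det g]. *)
Definition gauss_curvature (g : metric) (p : R * R) : R :=
  sum_axes (fun l => riemann g l ax1 ax2 ax2 p * gcoef g l ax1 p) / gdet g p.

Definition gradient (g : metric) (f : R * R -> R) (p : R * R) : R * R :=
  (sum_axes (fun j => ginv g ax1 j p * partial j f p),
   sum_axes (fun j => ginv g ax2 j p * partial j f p)).

Definition isometry (A : R * R -> Prop) (g : metric)
    (B : R * R -> Prop) (g' : metric) (phi : R * R -> R * R) : Prop :=
  exists psi : R * R -> R * R,
    (forall p, A p -> B (phi p) /\ psi (phi p) = p) /\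
    (forall q, B q -> A (psi q) /\ phi (psi q) = q) /\
    class_C_map 3 A phi /\ class_C_map 3 B psi /\
    (forall p u v, A p -> g' (phi p) (diff_map phi p u) (diff_map phi p v) = g p u v).

Definition isometric (A : R * R -> Prop) (g : metric)
    (B : R * R -> Prop) (g' : metric) : Prop :=
  exists phi, isometry A g B g' phi.

(** Every point of [U] has an open neighbourhood in [U] isometric to an open
    subset of [D]. *)
Definition locally_isometric (U : R * R -> Prop) (g : metric)
    (D : R * R -> Prop) (g' : metric) : Prop :=
  forall p, U p ->
    exists A B : R * R -> Prop,
      open A /\ A p /\ (forall q, A q -> U q) /\
      open B /\ (forall q, B q -> D q) /\
      isometric A g B g'.

Definition dense (U : R * R -> Prop) : Prop :=
  forall A : R * R -> Prop, open A -> (exists p, A p) -> exists p, A p /\ U p.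

Definition velocity (c : R -> R * R) (t : R) : R * R :=
  (Derive (fun s => fst (c s)) t, Derive (fun s => snd (c s)) t).

(** [C^1] curves in [D] from [p] to [q]. The velocity may vanish, so that
    corners can be smoothed by reparametrization and these curves have the same
    lengths as piecewise [C^1] ones. *)
Definition C1_curve (D : R * R -> Prop) (p q : R * R) (c : R -> R * R) : Prop :=
  c 0 = p /\ c 1 = q /\
  (forall t, 0 <= t <= 1 ->
     D (c t) /\
     ex_derive (fun s => fst (c s)) t /\ ex_derive (fun s => snd (c s)) t /\
     continuous (velocity c) t).

Definition curve_length (g : metric) (c : R -> R * R) : R :=
  RInt (fun t => sqrt (g (c t) (velocity c t) (velocity c t))) 0 1.

Definition riem_dist (D : R * R -> Prop) (g : metric) (p q : R * R) : Rbar :=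
  Glb_Rbar (fun L => exists c, C1_curve D p q c /\ L = curve_length g c).

Definition complete_metric (D : R * R -> Prop) (g : metric) : Prop :=
  forall u : nat -> R * R,
    (forall n, D (u n)) ->
    (forall eps : R, 0 < eps -> exists N : nat, forall m n : nat,
       (N <= m)%nat -> (N <= n)%nat -> Rbar_lt (riem_dist D g (u m) (u n)) eps) ->
    exists p, D p /\
      forall eps : R, 0 < eps -> exists N : nat, forall n : nat,
        (N <= n)%nat -> Rbar_lt (riem_dist D g (u n) p) eps.

Definition unit_interval (t : R) : Prop := 0 <= t <= 1.

Definition is_path {X : UniformSpace} (x y : X) (c : R -> X) : Prop :=
  continuous_on unit_interval c /\ c 0 = x /\ c 1 = y.

Definition simply_connected (X : UniformSpace) : Prop :=
  (exists x : X, True) /\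
  (forall x y : X, exists c, is_path x y c) /\
  (forall (x : X) (c : R -> X), is_path x x c ->
     exists H : R * R -> X,
       continuous_on (fun ts => unit_interval (fst ts) /\ unit_interval (snd ts)) H /\
       (forall t, unit_interval t -> H (t, 0) = c t /\ H (t, 1) = x) /\
       (forall s, unit_interval s -> H (0, s) = x /\ H (1, s) = x)).

(** [p] is a covering map from [X] onto the subspace [S] of [Y]. *)
Definition covering_map {X Y : UniformSpace} (p : X -> Y) (S : Y -> Prop) : Prop :=
  (forall x, continuous p x) /\
  (forall x, S (p x)) /\
  (forall y, S y -> exists x, p x = y) /\
  (forall y, S y ->
     exists V : Y -> Prop, open V /\ V y /\
     exists (I : Type) (U : I -> X -> Prop),
       (forall i, open (U i)) /\
       (forall i j x, U i x -> U j x -> i = j) /\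
       (forall x, V (p x) <-> exists i, U i x) /\
       (forall i, exists q : Y -> X,
          continuous_on (fun z => V z /\ S z) q /\
          (forall z, V z -> S z -> U i (q z) /\ p (q z) = z) /\
          (forall x, U i x -> q (p x) = x))).

(** The metric induced on the plane by a map [Psi] into Euclidean 3-space. *)
Definition induced_metric (Psi : R * R -> R * R * R) : metric :=
  fun p u v =>
    let X := fun q => fst (fst (Psi q)) in
    let Y := fun q => snd (fst (Psi q)) in
    let Z := fun q => snd (Psi q) in
    diff X p u * diff X p v + diff Y p u * diff Y p v + diff Z p u * diff Z p v.

Definition class_C_map3 (n : nat) (D : R * R -> Prop) (Psi : R * R -> R * R * R) : Prop :=
  class_C n D (fun q => fst (fst (Psi q))) /\
  class_C n D (fun q => snd (fst (Psi q))) /\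
  class_C n D (fun q => snd (Psi q)).

(** The plane with the metric [g] is, via [Psi], the Riemannian universal cover
    of the surface [S] of Euclidean 3-space. As [g] is positive definite, the
    last two conditions make [Psi] an immersion; together with the covering
    property its restrictions to sheets are local parametrizations of [S], and
    [Psi] is a local isometry for the metric induced on [S]. *)
Definition riemannian_universal_cover (g : metric)
    (Psi : R * R -> R * R * R) (S : R * R * R -> Prop) : Prop :=
  riemannian_metric plane g /\
  simply_connected (prod_UniformSpace R_UniformSpace R_UniformSpace) /\
  covering_map Psi S /\
  class_C_map3 3 plane Psi /\
  (forall p u v, induced_metric Psi p u v = g p u v).

(** Below, [Cs] stands for [C^*]; all functions of [xi] are only meaningful for [0 < xi]. *)

Definition T (C xi : R) : R := - Rpower xi (8 / 3) + 3 * C * xi ^ 2 - 3.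

(** [iota P] is the unique real number satisfying [P]. *)
Definition xi01 (C : R) : R :=
  iota (fun a : R => exists b, 0 < a < b /\ T C a = 0 /\ T C b = 0).

Definition xi02 (C : R) : R :=
  iota (fun b : R => exists a, 0 < a < b /\ T C a = 0 /\ T C b = 0).

Definition xi00 (C : R) : R := Rpower (9 / 4 * C) (3 / 2).

Definition D_C (C : R) (p : R * R) : Prop := xi01 C < fst p < xi02 C.

Definition g_C (C : R) : metric :=
  diag_metric (fun p => 3 / (fst p ^ 2 * T C (fst p))) (fun p => 1 / fst p ^ 2).

Definition h0 (C Cs xi : R) : R :=
  RInt (fun tau => sqrt ((3 * tau ^ 2 - Cs ^ 2 * T C tau) / (tau ^ 4 * T C tau)))
       (xi00 C) xi.

Definition h0_m1 (C Cs : R) : R :=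
  iota (fun l : R => filterlim (h0 C Cs) (at_right (xi01 C)) (locally l)).

Definition h0_1 (C Cs : R) : R :=
  iota (fun l : R => filterlim (h0 C Cs) (at_left (xi02 C)) (locally l)).

(** The break point [h_{0,k}]; only used for [k <> 0]. *)
Definition h0_k (C Cs : R) (k : Z) : R :=
  if (1 <=? k)%Z
  then IZR k * h0_1 C Cs - (IZR k - 1) * h0_m1 C Cs
  else - IZR k * h0_m1 C Cs + (IZR k + 1) * h0_1 C Cs.

Definition h_k (C Cs : R) (k : Z) (xi : R) : R :=
  if Z.even k
  then IZR k * (h0_1 C Cs - h0_m1 C Cs) + h0 C Cs xi
  else (IZR k + 1) * h0_1 C Cs - (IZR k - 1) * h0_m1 C Cs - h0 C Cs xi.

(** The value of [F] at [h_{0,k}], for [k <> 0]. *)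
Definition F_end (C : R) (k : Z) : R :=
  if (1 <=? k)%Z
  then (if Z.odd k then xi02 C else xi01 C)
  else (if Z.odd k then xi01 C else xi02 C).

(** The graph of [F]: the inverses of the [h_k], together with the values at
    the break points. *)
Definition F_graph (C Cs h x : R) : Prop :=
  (exists k : Z, xi01 C < x < xi02 C /\ h_k C Cs k x = h) \/
  (exists k : Z, k <> 0%Z /\ h = h0_k C Cs k /\ x = F_end C k).

Definition F (C Cs h : R) : R := iota (fun x : R => F_graph C Cs h x).

Definition g_CCs (C Cs : R) : metric :=
  diag_metric
    (fun p => 3 * F C Cs (fst p) ^ 2 /
              (3 * F C Cs (fst p) ^ 2 - Cs ^ 2 * T C (F C Cs (fst p))))
    (fun p => 1 / F C Cs (fst p) ^ 2).

Definition Psi (C Cs : R) (p : R * R) : R * R * R :=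
  (Cs / F C Cs (fst p) * cos (snd p / Cs),
   Cs / F C Cs (fst p) * sin (snd p / Cs),
   fst p).

Definition Psi_surface (C Cs : R) (x : R * R * R) : Prop :=
  exists p, Psi C Cs p = x.

Definition Cs_range (C Cs : R) : Prop :=
  0 < Cs < Rpower (C - 4 / Rpower 3 (3 / 2)) (- (1 / 2)).

(* Main.v *)
Require Import Defs.
From Stdlib Require Import Reals ZArith Lra Lia FunctionalExtensionality ClassicalEpsilon.
From Coquelicot Require Import Coquelicot.

Open Scope R_scope.

(** One parameter [t] uniformizes the whole picture. With [y = xi^(2/3)] the
    function [T] becomes the quartic [- y^4 + 3 C y^3 - 3], which factors as
    [(y - ymin) (ymax - y) (y^2 + lin y + cst)] with [lin, cst > 0]
    ([quartic_factorization_exists]). Substituting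
    [y = (ymin + ymax) / 2 + (ymax - ymin) / 2 * sin t] makes the first two
    factors the square of a multiple of [cos t], so that the square root of [T],
    which is singular at the turning points of [F], is replaced by a function of
    [t] that is smooth on the whole line.

    The arc length [s] of the profile curve and the height [h] satisfy
    [ds/dt = arc_density t] and [dh/dt = dens t], both smooth, even about the
    odd multiples of [PI / 2], and bounded below by positive constants; the
    hypothesis on [Cs] is what keeps [dens] away from zero. By symmetry the
    branch [h_k] of the definition of [F] lives on the [k]-th interval of length
    [PI] of the parameter, and the break points [h_{0,k}] are the heights of the
    odd multiples of [PI / 2]. Hence [F (height t) = xipar t] for all [t]
    ([F_height]): [F] is [xipar] composed with the inverse of [height], and its
    regularity comes from the one of that inverse, break points included.

    Everything else is read off from this formula. With [w = 1 / F], the metric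
    is [ds^2 + w^2 dtheta^2], where [dw/ds] and [d^2w/ds^2] are the functions
    [vpar] and [apar] of [t], none of which involves [Cs]. The curvature is
    [- apar / wpar = 1 - F^(8/3) / 9]; its gradient vanishes only where
    [cos t = 0]. Matching the parameter [t] of two values of [Cs] is an isometry
    ([isometric_planes]), and on an open half period of [t] the map
    [(h, theta) -> (F h, theta)] is an isometry onto [(D_C, g_C)]
    ([local_isometry]). The coefficients are bounded above and below by positive
    constants, which gives completeness ([complete_rotational]). Finally a
    surface of revolution about an axis that it does not meet is covered by its
    parameter plane, with sheets over half-spaces ([covering_revolve]), and the
    plane is simply connected. *)

(** * Functions of class C^n of one variable *)

(** One-variable counterpart of [class_C], relative to a set [D] so that it also applies to
    powers, square roots and [asin], which are smooth only on an open set. *)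
Fixpoint Ck (n : nat) (D : R -> Prop) (f : R -> R) : Prop :=
  match n with
  | O => forall x, D x -> continuous f x
  | S m => (forall x, D x -> ex_derive f x) /\ Ck m D (Derive f)
  end.

Definition line : R -> Prop := fun _ => True.
Definition positive_reals : R -> Prop := fun x => 0 < x.

Lemma open_line : open line.
Proof. apply open_true. Qed.

Lemma open_positive_reals : open positive_reals.
Proof. apply open_gt. Qed.

Lemma Ck_ext n (D : R -> Prop) f g :
  open D -> (forall x, D x -> f x = g x) -> Ck n D f -> Ck n D g.
Proof.
  intros HD. revert f g. induction n as [|n IH]; simpl; intros f g E H.
  - intros x Hx. apply continuous_ext_loc with f; [|auto].
    apply (locally_open D); auto.
  - destruct H as [H1 H2]. split.
    + intros x Hx. apply ex_derive_ext_loc with f; [|auto].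
      apply (locally_open D); auto.
    + apply IH with (Derive f); auto. intros x Hx. apply Derive_ext_loc.
      apply (locally_open D); auto.
Qed.

Lemma Ck_subset n (D D' : R -> Prop) f :
  (forall x, D x -> D' x) -> Ck n D' f -> Ck n D f.
Proof.
  intros HD. revert f; induction n as [|n IH]; simpl; intros f H; [auto|].
  destruct H; split; auto.
Qed.

(** Smoothness is proved by induction on [n] whenever the derivative [f'] is again of the form
    under study. *)
Lemma Ck_S n (D : R -> Prop) f f' :
  open D -> (forall x, D x -> is_derive f x (f' x)) -> Ck n D f' -> Ck (S n) D f.
Proof.
  intros HD Hf H. split.
  - intros x Hx. exists (f' x). auto.
  - apply Ck_ext with f'; auto. intros x Hx. symmetry. apply is_derive_unique. auto.
Qed.

Lemma Ck_continuous n D f : Ck n D f -> forall x, D x -> continuous f x.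
Proof.
  destruct n; simpl; [auto|]. intros [H _] x Hx.
  apply @ex_derive_continuous. auto.
Qed.

Lemma Ck_pred n (D : R -> Prop) f : Ck (S n) D f -> Ck n D f.
Proof.
  revert f. induction n as [|n IH]; intros f H.
  - intros x Hx. apply (Ck_continuous _ _ _ H x Hx).
  - destruct H as [H1 H2]. split; auto.
Qed.

Lemma Ck_const n D c : Ck n D (fun _ => c).
Proof.
  revert c. induction n as [|n IH]; intros c.
  - intros x _. apply continuous_const.
  - split.
    + intros x _. apply ex_derive_const.
    + replace (Derive (fun _ : R => c)) with (fun _ : R => 0); auto.
      extensionality x. now rewrite Derive_const.
Qed.

Lemma Ck_id n D : open D -> Ck n D (fun x => x).
Proof.
  intros HD. destruct n.
  - intros x _. apply continuous_id.
  - apply Ck_S with (fun _ => 1); auto using Ck_const.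
    intros x _. apply @is_derive_id.
Qed.

Lemma Ck_plus n D f g : open D -> Ck n D f -> Ck n D g -> Ck n D (fun x => f x + g x).
Proof.
  intros HD. revert f g. induction n as [|n IH]; intros f g Hf Hg.
  - intros x Hx. apply @continuous_plus; auto.
  - destruct Hf as [Hf1 Hf2], Hg as [Hg1 Hg2].
    apply Ck_S with (fun x => Derive f x + Derive g x); auto.
    intros x Hx. apply @is_derive_plus; apply Derive_correct; auto.
Qed.

Lemma Ck_mult n D f g : open D -> Ck n D f -> Ck n D g -> Ck n D (fun x => f x * g x).
Proof.
  intros HD. revert f g. induction n as [|n IH]; intros f g Hf Hg.
  - intros x Hx. apply @continuous_mult; auto.
  - pose proof (Ck_pred _ _ _ Hf). pose proof (Ck_pred _ _ _ Hg).
    destruct Hf as [Hf1 Hf2], Hg as [Hg1 Hg2].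
    apply Ck_S with (fun x => Derive f x * g x + f x * Derive g x); auto.
    + intros x Hx. apply is_derive_Reals. apply derivable_pt_lim_mult;
        apply is_derive_Reals; apply Derive_correct; auto.
    + apply Ck_plus; auto.
Qed.

Lemma Ck_comp n (D D' : R -> Prop) g f :
  open D -> (forall x, D x -> D' (f x)) -> Ck n D' g -> Ck n D f ->
  Ck n D (fun x => g (f x)).
Proof.
  intros HD HDD. revert g. induction n as [|n IH]; intros g Hg Hf.
  - intros x Hx. apply (continuous_comp f g); auto.
  - pose proof (Ck_pred _ _ _ Hf).
    destruct Hf as [Hf1 Hf2], Hg as [Hg1 Hg2].
    apply Ck_S with (fun x => Derive f x * Derive g (f x)); auto.
    + intros x Hx. apply (is_derive_comp g f); apply Derive_correct; auto.
    + apply Ck_mult; auto.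
Qed.

Lemma Ck_opp n D f : open D -> Ck n D f -> Ck n D (fun x => - f x).
Proof.
  intros HD H. apply Ck_ext with (fun x => -1 * f x); auto.
  - intros; ring.
  - apply Ck_mult; auto using Ck_const.
Qed.

Lemma Ck_minus n D f g : open D -> Ck n D f -> Ck n D g -> Ck n D (fun x => f x - g x).
Proof. intros. apply Ck_plus; auto. apply Ck_opp; auto. Qed.

Lemma Ck_pow n D f k : open D -> Ck n D f -> Ck n D (fun x => f x ^ k).
Proof.
  intros HD H. induction k; simpl.
  - apply Ck_const.
  - apply Ck_mult; auto.
Qed.

Lemma Ck_Rinv n : Ck n positive_reals Rinv.
Proof.
  induction n as [|n IH].
  - intros x Hx. apply continuous_Rinv. unfold positive_reals in Hx. lra.
  - apply Ck_S with (fun x => - (/ x * / x)); auto using open_positive_reals.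
    + intros x Hx. unfold positive_reals in Hx. auto_derive; [lra|]. field. lra.
    + apply Ck_opp; auto using open_positive_reals. apply Ck_mult; auto using open_positive_reals.
Qed.

Lemma Ck_inv n D f :
  open D -> (forall x, D x -> 0 < f x) -> Ck n D f -> Ck n D (fun x => / f x).
Proof. intros HD Hp H. apply (Ck_comp n D positive_reals Rinv f); auto using Ck_Rinv. Qed.

Lemma Ck_div n D f g :
  open D -> (forall x, D x -> 0 < g x) -> Ck n D f -> Ck n D g ->
  Ck n D (fun x => f x / g x).
Proof. intros HD Hp H H'. apply Ck_mult; auto. apply Ck_inv; auto. Qed.

Lemma Ck_sqrt n : Ck n positive_reals sqrt.
Proof.
  induction n as [|n IH].
  - intros x Hx. apply continuous_sqrt.
  - apply Ck_S with (fun x => / (2 * sqrt x)); auto using open_positive_reals.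
    + intros x Hx. unfold positive_reals in Hx. auto_derive; [lra|].
      field. apply Rgt_not_eq, sqrt_lt_R0. lra.
    + apply Ck_inv; auto using open_positive_reals.
      * intros x Hx. apply Rmult_lt_0_compat; [lra|]. now apply sqrt_lt_R0.
      * apply Ck_mult; auto using open_positive_reals, Ck_const.
Qed.

Lemma Ck_sqrt_comp n D f :
  open D -> (forall x, D x -> 0 < f x) -> Ck n D f -> Ck n D (fun x => sqrt (f x)).
Proof. intros HD Hp H. apply (Ck_comp n D positive_reals sqrt f); auto using Ck_sqrt. Qed.

(** The induction must let the exponent vary, as differentiation lowers it. *)
Lemma Ck_Rpower n a : Ck n positive_reals (fun x => Rpower x a).
Proof.
  revert a. induction n as [|n IH]; intros a.
  - intros x Hx. apply @ex_derive_continuous. exists (a * Rpower x (a - 1)).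
    apply is_derive_Reals. now apply derivable_pt_lim_power.
  - apply Ck_S with (fun x => a * Rpower x (a - 1)); auto using open_positive_reals.
    + intros x Hx. apply is_derive_Reals. now apply derivable_pt_lim_power.
    + apply Ck_mult; auto using open_positive_reals, Ck_const.
Qed.

Lemma Ck_sin_cos n : Ck n line sin /\ Ck n line cos.
Proof.
  induction n as [|n [IHs IHc]].
  - split; intros x _; [apply continuous_sin | apply continuous_cos].
  - split.
    + apply Ck_S with cos; auto using open_line.
      intros x _. apply is_derive_Reals, derivable_pt_lim_sin.
    + apply Ck_S with (fun x => - sin x); auto using open_line.
      * intros x _. apply is_derive_Reals, derivable_pt_lim_cos.
      * apply Ck_opp; auto using open_line.
Qed.

Lemma is_derive_asin x : -1 < x < 1 -> is_derive asin x (/ sqrt (1 - x * x)).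
Proof.
  intros Hx. apply is_derive_Reals.
  pose proof (derive_pt_asin x Hx) as H.
  apply derive_pt_eq_1 in H. unfold Rsqr in H.
  replace (/ sqrt (1 - x * x)) with (1 / sqrt (1 - x * x)); auto.
  unfold Rdiv; ring.
Qed.

Definition unit_ball : R -> Prop := fun x => -1 < x < 1.

Lemma open_between a b : open (fun x : R => a < x < b).
Proof. apply open_and; [apply open_gt | apply open_lt]. Qed.

Lemma Ck_asin n : Ck n unit_ball asin.
Proof.
  assert (O : open unit_ball) by apply open_between.
  destruct n.
  - intros x Hx. apply @ex_derive_continuous. eexists. now apply is_derive_asin.
  - apply Ck_S with (fun x => / sqrt (1 - x * x)); auto using is_derive_asin.
    assert (P : forall x, unit_ball x -> 0 < 1 - x * x).
    { unfold unit_ball; intros x Hx. nra. }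
    apply Ck_inv; auto.
    + intros x Hx. apply sqrt_lt_R0. auto.
    + apply Ck_sqrt_comp; auto. apply Ck_minus; auto using Ck_const.
      apply Ck_mult; auto using Ck_id.
Qed.

(** * Functions of separated variables on the plane *)

(** Products of a function of the first coordinate and one of the second form a family
    closed under both partial derivatives; all coefficients and maps below belong to it. *)
Lemma partial_ax1_prod f g :
  partial ax1 (fun p => f (fst p) * g (snd p)) = fun p => Derive f (fst p) * g (snd p).
Proof.
  extensionality p. unfold partial; simpl.
  rewrite (Derive_ext _ (fun t => g (snd p) * f t)) by (intros; ring).
  rewrite Derive_scal. ring.
Qed.

Lemma partial_ax2_prod f g :
  partial ax2 (fun p => f (fst p) * g (snd p)) = fun p => f (fst p) * Derive g (snd p).
Proof. extensionality p. unfold partial; simpl. apply Derive_scal. Qed.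

Lemma class_C_prod n (D : R -> Prop) f g :
  Ck n D f -> Ck n line g ->
  class_C n (fun p => D (fst p)) (fun p => f (fst p) * g (snd p)).
Proof.
  revert f g. induction n as [|n IH]; intros f g Hf Hg.
  - intros p Hp. simpl in Hf, Hg.
    apply (continuous_mult (fun p : R * R => f (fst p)) (fun p : R * R => g (snd p))).
    + apply (continuous_comp fst f); auto. apply continuous_fst.
    + apply (continuous_comp snd g); [apply continuous_snd | now apply Hg].
  - pose proof (Ck_pred _ _ _ Hf). pose proof (Ck_pred _ _ _ Hg).
    destruct Hf as [Hf1 Hf2], Hg as [Hg1 Hg2]. split.
    + intros i p Hp. destruct i; simpl.
      * apply @ex_derive_mult; [auto | apply ex_derive_const].
      * apply @ex_derive_mult; [apply ex_derive_const | now apply Hg1].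
    + intros i. destruct i.
      * rewrite partial_ax1_prod. auto.
      * rewrite partial_ax2_prod. auto.
Qed.

Lemma class_C_fst n (D : R -> Prop) f :
  Ck n D f -> class_C n (fun p => D (fst p)) (fun p => f (fst p)).
Proof.
  intros H. replace (fun p : R * R => f (fst p)) with (fun p : R * R => f (fst p) * 1)
    by (extensionality p; ring).
  apply (class_C_prod n D f (fun _ => 1)); auto using Ck_const.
Qed.

Lemma class_C_snd n (D : R -> Prop) g :
  Ck n line g -> class_C n (fun p => D (fst p)) (fun p => g (snd p)).
Proof.
  intros H. replace (fun p : R * R => g (snd p)) with (fun p : R * R => 1 * g (snd p))
    by (extensionality p; ring).
  apply (class_C_prod n D (fun _ => 1) g); auto using Ck_const.
Qed.

(** * Inverse functions on the line *)

(** The difference quotient of [g] at [y] is the inverse of a difference quotient of [f] at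
    [g y], whose increment tends to zero by continuity of [g]. *)
Lemma is_derive_inverse (f g : R -> R) (y d : R) :
  (forall y, f (g y) = y) -> continuous g y -> is_derive f (g y) d -> d <> 0 ->
  is_derive g y (/ d).
Proof.
  intros Hfg Hc Hd Hd0.
  apply is_derive_Reals. apply is_derive_Reals in Hd.
  pose proof (proj1 (filterlim_locally g (g y)) Hc) as Hc'.
  intros eps Heps.
  (* |1/q - 1/d| < eps as soon as |q - d| < min (|d|/2, eps d^2/2) *)
  assert (Hm : 0 < Rmin (Rabs d / 2) (eps * d ^ 2 / 2)).
  { apply Rmin_glb_lt. apply Rabs_pos_lt in Hd0. lra.
    pose proof (pow2_gt_0 d Hd0). nra. }
  destruct (Hd _ Hm) as [del Hdel].
  destruct (Hc' del) as [gam Hgam].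
  exists gam. intros k Hk0 Hk.
  set (l := g (y + k) - g y).
  assert (Hl : Rabs l < del).
  { specialize (Hgam (y + k)). apply Hgam.
    unfold ball; simpl; unfold AbsRing_ball, abs, minus, plus, opp; simpl.
    replace (y + k + - y) with k by ring. auto. }
  assert (Hl0 : l <> 0).
  { intros E. apply Hk0. unfold l in E.
    assert (E' : g (y + k) = g y) by lra. apply (f_equal f) in E'.
    rewrite !Hfg in E'. lra. }
  specialize (Hdel l Hl0 Hl).
  replace (g y + l) with (g (y + k)) in Hdel by (unfold l; ring).
  rewrite !Hfg in Hdel.
  replace (y + k - y) with k in Hdel by ring.
  (* The difference quotient of [f], close to [d] by [Hdel]. *)
  set (q := k / l) in *.
  assert (Hq : Rabs (q - d) < Rabs d / 2) by (eapply Rlt_le_trans; [apply Hdel | apply Rmin_l]).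
  assert (Hq' : Rabs (q - d) < eps * d ^ 2 / 2) by (eapply Rlt_le_trans; [apply Hdel | apply Rmin_r]).
  assert (Hqa : Rabs d / 2 < Rabs q).
  { pose proof (Rabs_triang_inv d q) as Ht. rewrite (Rabs_minus_sym d q) in Ht. lra. }
  assert (Hd1 := Rabs_pos_lt d Hd0).
  assert (Hq0 : q <> 0). { intros E. rewrite E, Rabs_R0 in Hqa. lra. }
  replace (l / k - / d) with ((d - q) * / (q * d)).
  2:{ unfold q. field. repeat split; auto. }
  rewrite Rabs_mult, Rabs_inv, Rabs_mult, Rabs_minus_sym.
  apply Rmult_lt_reg_r with (Rabs q * Rabs d); [nra|].
  rewrite Rmult_assoc, Rinv_l, Rmult_1_r by nra.
  eapply Rlt_le_trans; [apply Hq'|].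
  rewrite <- (pow2_abs d).
  assert (Hprod : Rabs d / 2 * Rabs d <= Rabs q * Rabs d) by nra.
  apply (Rmult_le_compat_l eps) in Hprod; lra.
Qed.

Lemma strictly_increasing_of_derive (f f' : R -> R) :
  (forall x, is_derive f x (f' x)) -> (forall x, 0 < f' x) ->
  forall x y, x < y -> f x < f y.
Proof.
  intros Hf Hp x y Hxy.
  destruct (MVT_gen f x y f') as [z [Hz E]].
  - intros; apply Hf.
  - intros z _. apply continuity_pt_filterlim. apply @ex_derive_continuous.
    now exists (f' z).
  - specialize (Hp z). nra.
Qed.

Lemma derive_zero_const (f : R -> R) (a b : R) :
  (forall x, Rmin a b <= x <= Rmax a b -> is_derive f x 0) -> f a = f b.
Proof.
  intros Hf. destruct (MVT_gen f a b (fun _ => 0)) as [z [Hz E]].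
  - intros x Hx. apply Hf. lra.
  - intros x Hx. apply continuity_pt_filterlim. apply @ex_derive_continuous.
    exists 0. auto.
  - lra.
Qed.

(** The lower bound [c] makes [f] proper, hence onto, and makes the inverse Lipschitz with
    constant [/ c], hence continuous, so that [is_derive_inverse] applies. *)
Lemma global_inverse (f f' : R -> R) (c : R) :
  0 < c -> (forall x, is_derive f x (f' x)) -> (forall x, c <= f' x) ->
  exists g, (forall y, f (g y) = y) /\ (forall x, g (f x) = x) /\
            (forall y, is_derive g y (/ f' (g y))).
Proof.
  intros Hc Hf Hf'.
  assert (Hinc : forall x y, x <= y -> c * (y - x) <= f y - f x).
  { intros x y Hxy. destruct (MVT_gen f x y f') as [z [Hz E]].
    - intros; apply Hf.
    - intros z _. apply continuity_pt_filterlim. apply @ex_derive_continuous.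
      now exists (f' z).
    - rewrite E. specialize (Hf' z). nra. }
  assert (Hsurj : forall y, exists x, f x = y).
  (* As [f] has slope at least [c], it passes the value [y] between [- M] and [M]. *)
  { intros y. set (M := (Rabs (y - f 0) + 1) / c).
    assert (HM : 0 < M). { apply Rdiv_lt_0_compat; auto. pose proof (Rabs_pos (y - f 0)). lra. }
    assert (HcM : c * M = Rabs (y - f 0) + 1) by (unfold M; field; lra).
    pose proof (Hinc 0 M ltac:(lra)) as H1. pose proof (Hinc (-M) 0 ltac:(lra)) as H2.
    pose proof (Rle_abs (y - f 0)). pose proof (Rle_abs (- (y - f 0))) as H3.
    rewrite Rabs_Ropp in H3.
    destruct (IVT_gen f (-M) M y) as [x [_ Hx]]; [| |now exists x].
    - intros z. apply continuity_pt_filterlim. apply @ex_derive_continuous. now exists (f' z).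
    - rewrite Rmin_left, Rmax_right by nra. nra. }
  set (g := fun y => proj1_sig (constructive_indefinite_description _ (Hsurj y))).
  assert (Hfg : forall y, f (g y) = y).
  { intros y. unfold g. destruct constructive_indefinite_description; auto. }
  assert (Hlip : forall x y, Rabs (x - y) <= Rabs (f x - f y) / c).
  { intros x y. apply Rmult_le_reg_r with c; auto. unfold Rdiv.
    rewrite Rmult_assoc, Rinv_l by lra. rewrite Rmult_1_r.
    destruct (Rle_dec x y) as [H|H].
    - pose proof (Hinc x y H). rewrite (Rabs_left1 (x - y)), (Rabs_left1 (f x - f y)) by nra. lra.
    - pose proof (Hinc y x ltac:(lra)). rewrite (Rabs_right (x - y)), (Rabs_right (f x - f y)) by nra. lra. }
  assert (Hgf : forall x, g (f x) = x).
  { intros x. pose proof (Hlip (g (f x)) x) as H. rewrite Hfg, Rminus_diag in H.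
    rewrite Rabs_R0 in H. unfold Rdiv in H. rewrite Rmult_0_l in H.
    pose proof (Rabs_pos (g (f x) - x)). destruct (Req_dec (g (f x) - x) 0) as [E|E]; [lra|].
    apply Rabs_pos_lt in E. lra. }
  exists g. split; [|split]; auto.
  intros y. apply is_derive_inverse with f; auto.
  - apply filterlim_locally. intros eps.
    assert (He : 0 < eps * c) by (apply Rmult_lt_0_compat; auto; apply eps).
    exists (mkposreal _ He). intros z Hz. pose proof (Hlip (g z) (g y)) as H.
    rewrite !Hfg in H.
    assert (Hz' : Rabs (z - y) < eps * c) by exact Hz.
    change (Rabs (g z - g y) < eps). apply Rle_lt_trans with (1 := H).
    apply Rmult_lt_reg_r with c; auto. unfold Rdiv. rewrite Rmult_assoc, Rinv_l by lra. lra.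
  - specialize (Hf' (g y)). lra.
Qed.

(** * Curvature of rotationally invariant metrics *)

Lemma partial_fst_ax1 f : partial ax1 (fun p => f (fst p)) = fun p => Derive f (fst p).
Proof. reflexivity. Qed.

Lemma partial_fst_ax2 f : partial ax2 (fun p => f (fst p)) = fun _ => 0.
Proof. extensionality p. unfold partial; simpl. apply Derive_const. Qed.

Lemma partial_const i c : partial i (fun _ => c) = fun _ => 0.
Proof. extensionality p. destruct i; unfold partial; simpl; apply Derive_const. Qed.

Lemma gcoef_diag a b i j :
  gcoef (diag_metric a b) i j =
  match i, j with ax1, ax1 => a | ax2, ax2 => b | _, _ => fun _ => 0 end.
Proof.
  extensionality p. unfold gcoef, diag_metric. destruct i, j; simpl; ring.
Qed.

(** Metrics invariant under translation of the second coordinate. *)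
Definition rotational_metric (E G : R -> R) : metric :=
  diag_metric (fun p => E (fst p)) (fun p => G (fst p)).

Lemma christoffel_rotational E G : (forall x, 0 < E x) -> (forall x, 0 < G x) ->
  forall k i j, christoffel (rotational_metric E G) k i j = fun p => let x := fst p in
    match k, i, j with
    | ax1, ax1, ax1 => Derive E x / (2 * E x)
    | ax1, ax2, ax2 => - Derive G x / (2 * E x)
    | ax2, ax1, ax2 | ax2, ax2, ax1 => Derive G x / (2 * G x)
    | _, _, _ => 0
    end.
Proof.
  intros HE HG k i j. extensionality p. unfold rotational_metric.
  pose proof (Rgt_not_eq _ _ (HE (fst p))). pose proof (Rgt_not_eq _ _ (HG (fst p))).
  unfold christoffel, sum_axes, ginv, gdet. rewrite !gcoef_diag.
  destruct k, i, j; rewrite ?partial_fst_ax1, ?partial_fst_ax2, ?partial_const; simpl; field; auto.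
Qed.

(** With [E = e^2] and [G = w^2], arc length along the first coordinate satisfies
    [ds = e dx]; so [v] and [a] are the first and second derivatives of [w] with
    respect to [s], and this is the classical formula [K = - w''/w] for the metric
    [ds^2 + w^2 dtheta^2]. *)
Lemma gauss_curvature_rotational (E G e w v a : R -> R) :
  (forall x, E x = e x ^ 2) -> (forall x, G x = w x ^ 2) ->
  (forall x, 0 < e x) -> (forall x, 0 < w x) ->
  (forall x, ex_derive e x) ->
  (forall x, is_derive w x (e x * v x)) -> (forall x, is_derive v x (e x * a x)) ->
  gauss_curvature (rotational_metric E G) = fun p => - a (fst p) / w (fst p).
Proof.
  intros HE HG He Hw De Dw Dv.
  assert (HE0 : forall x, 0 < E x) by (intros; rewrite HE; apply pow_lt; auto).
  assert (HG0 : forall x, 0 < G x) by (intros; rewrite HG; apply pow_lt; auto).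
  assert (DE : Derive E = fun x => 2 * e x * Derive e x).
  { extensionality x. rewrite (Derive_ext _ _ x HE), Derive_pow; simpl; auto. ring. }
  assert (DG : Derive G = fun x => 2 * w x * (e x * v x)).
  { extensionality x. rewrite (Derive_ext _ _ x HG), Derive_pow; simpl.
    rewrite (is_derive_unique _ _ _ (Dw x)). ring. eexists; apply Dw. }
  extensionality p. unfold gauss_curvature, gdet, riemann, sum_axes.
  rewrite !christoffel_rotational by auto. unfold rotational_metric. rewrite !gcoef_diag. cbv zeta.
  rewrite (partial_fst_ax1 (fun x => - Derive G x / (2 * E x))).
  rewrite (partial_fst_ax2 (fun x => Derive G x / (2 * G x))), partial_const.
  assert (D2 : Derive (fun x => - Derive G x / (2 * E x)) = fun x =>
     - v x ^ 2 - w x * a x + w x * v x * Derive e x / e x ^ 2).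
  { extensionality x. pose proof (Rgt_not_eq _ _ (He x)).
    rewrite (Derive_ext _ (fun x => - (w x * v x) / e x)).
    2:{ intros t. rewrite DG, HE. pose proof (Rgt_not_eq _ _ (He t)). field. auto. }
    apply is_derive_unique. auto_derive.
    - repeat split; auto. eexists; apply Dw. eexists; apply Dv.
    - change (Derive (fun x => w x) x) with (Derive w x).
      change (Derive (fun x => v x) x) with (Derive v x).
      change (Derive (fun x => e x) x) with (Derive e x).
      rewrite (is_derive_unique _ _ _ (Dw x)), (is_derive_unique _ _ _ (Dv x)). field. auto. }
  rewrite D2, DG, DE. rewrite HE, HG.
  pose proof (Rgt_not_eq _ _ (He (fst p))). pose proof (Rgt_not_eq _ _ (Hw (fst p))).
  field. auto.
Qed.

Lemma gradient_rotational E G f p :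
  0 < E (fst p) -> 0 < G (fst p) ->
  fst (gradient (rotational_metric E G) (fun p => f (fst p)) p) = Derive f (fst p) / E (fst p).
Proof.
  intros HE HG. unfold rotational_metric, gradient, sum_axes, ginv, gdet. rewrite !gcoef_diag. cbn [fst].
  rewrite partial_fst_ax1, partial_fst_ax2. field. lra.
Qed.

Lemma riemannian_metric_rotational E G :
  (forall x, 0 < E x) -> (forall x, 0 < G x) -> Ck 3 line E -> Ck 3 line G ->
  riemannian_metric plane (rotational_metric E G).
Proof.
  intros HE HG CE CG. split; [|split; [|split]].
  - intros p u v _. unfold rotational_metric, diag_metric. ring.
  - intros p a u v w _. unfold rotational_metric, diag_metric, plus, scal; simpl.
    unfold prod_plus, prod_scal, scal, plus; simpl. unfold mult; simpl. ring.
  - intros p [u1 u2] _ Hu. unfold rotational_metric, diag_metric; simpl.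
    specialize (HE (fst p)). specialize (HG (fst p)).
    assert (0 <= u1 * u1) by nra. assert (0 <= u2 * u2) by nra.
    destruct (Req_dec u1 0) as [->|H1]; [destruct (Req_dec u2 0) as [->|H2]|].
    + now contradiction Hu.
    + assert (0 < u2 * u2) by nra. nra.
    + assert (0 < u1 * u1) by nra. nra.
  - intros i j. unfold rotational_metric. rewrite gcoef_diag. destruct i, j.
    + now apply (class_C_fst 3 line).
    + apply (class_C_fst 3 line (fun _ => 0)), Ck_const.
    + apply (class_C_fst 3 line (fun _ => 0)), Ck_const.
    + now apply (class_C_fst 3 line).
Qed.

(** * Completeness *)

Lemma rotational_norm_ge E G c p u :
  0 < c -> (forall x, c <= E x) -> (forall x, c <= G x) ->
  sqrt c * Rabs (fst u) <= sqrt (rotational_metric E G p u u) /\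
  sqrt c * Rabs (snd u) <= sqrt (rotational_metric E G p u u).
Proof.
  intros Hc HE HG. specialize (HE (fst p)). specialize (HG (fst p)).
  unfold rotational_metric, diag_metric.
  assert (0 <= fst u * fst u) by nra. assert (0 <= snd u * snd u) by nra.
  rewrite <- (sqrt_Rsqr_abs (fst u)), <- (sqrt_Rsqr_abs (snd u)), <- !sqrt_mult_alt by lra.
  unfold Rsqr. split; apply sqrt_le_1_alt; nra.
Qed.

Lemma speed_continuous E G cu t :
  (forall x, continuous E x) -> (forall x, continuous G x) ->
  ex_derive (fun s => fst (cu s)) t -> continuous (velocity cu) t ->
  continuous (fun t => sqrt (rotational_metric E G (cu t) (velocity cu t) (velocity cu t))) t.
Proof.
  intros CE CG H1 H3. apply continuous_sqrt_comp. unfold rotational_metric, diag_metric.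
  assert (C1 : continuous (fun t => fst (cu t)) t) by (apply @ex_derive_continuous; auto).
  assert (V1 : continuous (fun t => fst (velocity cu t)) t)
    by (apply (continuous_comp (velocity cu) fst); auto; apply continuous_fst).
  assert (V2 : continuous (fun t => snd (velocity cu t)) t)
    by (apply (continuous_comp (velocity cu) snd); auto; apply continuous_snd).
  apply @continuous_plus; apply @continuous_mult; try (apply @continuous_mult; assumption).
  - apply (continuous_comp (fun t => fst (cu t)) E); auto.
  - apply (continuous_comp (fun t => fst (cu t)) G); auto.
Qed.

(** The function [n] stands for the speed of a curve with coordinate function [f]. *)
Lemma displacement_le_length (f n : R -> R) k :
  0 < k ->
  (forall t, 0 <= t <= 1 -> ex_derive f t) ->
  (forall t, 0 <= t <= 1 -> continuous (Derive f) t) ->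
  (forall t, 0 <= t <= 1 -> continuous n t) ->
  (forall t, 0 <= t <= 1 -> k * Rabs (Derive f t) <= n t) ->
  k * Rabs (f 1 - f 0) <= RInt n 0 1.
Proof.
  intros Hk Hf Cf Cn Hle.
  assert (I : is_RInt (Derive f) 0 1 (f 1 - f 0)).
  { apply (is_RInt_derive f (Derive f)); rewrite Rmin_left, Rmax_right by lra; auto.
    intros x Hx. apply Derive_correct; auto. }
  assert (Ea : ex_RInt (fun t => Rabs (Derive f t)) 0 1).
  { apply (@ex_RInt_continuous R_CompleteNormedModule).
    rewrite Rmin_left, Rmax_right by lra. intros t Ht.
    apply (continuous_comp (Derive f) Rabs); auto. apply continuous_Rabs. }
  pose proof (abs_RInt_le (Derive f) 0 1 ltac:(lra) (ex_intro _ _ I)) as H1.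
  rewrite (is_RInt_unique _ _ _ _ I) in H1.
  apply Rle_trans with (k * RInt (fun t => Rabs (Derive f t)) 0 1).
  - apply Rmult_le_compat_l; lra.
  - replace (k * RInt (fun t => Rabs (Derive f t)) 0 1)
      with (RInt (fun t => k * Rabs (Derive f t)) 0 1)
      by exact (RInt_scal (fun t => Rabs (Derive f t)) 0 1 k Ea).
    apply RInt_le; [lra | | |].
    + exact (ex_RInt_scal (fun t => Rabs (Derive f t)) 0 1 k Ea).
    + apply (@ex_RInt_continuous R_CompleteNormedModule).
      rewrite Rmin_left, Rmax_right by lra. auto.
    + intros t Ht. apply Hle. lra.
Qed.

(** Each coordinate moves no faster than the speed divided by [sqrt c]. *)
Lemma curve_length_ge E G c p q cu :
  0 < c -> (forall x, c <= E x) -> (forall x, c <= G x) ->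
  (forall x, continuous E x) -> (forall x, continuous G x) ->
  C1_curve plane p q cu ->
  sqrt c * Rabs (fst q - fst p) <= curve_length (rotational_metric E G) cu /\
  sqrt c * Rabs (snd q - snd p) <= curve_length (rotational_metric E G) cu.
Proof.
  intros Hc HE HG CE CG [H0 [H1 Hcu]]. subst p q. unfold curve_length.
  split.
  - apply (displacement_le_length (fun t => fst (cu t))); try (intros t Ht; destruct (Hcu t Ht) as [_ [D1 [D2 V]]]).
    + now apply sqrt_lt_R0.
    + auto.
    + apply (continuous_comp (velocity cu) fst); auto; apply continuous_fst.
    + now apply speed_continuous.
    + apply (rotational_norm_ge E G c (cu t) (velocity cu t)); auto.
  - apply (displacement_le_length (fun t => snd (cu t))); try (intros t Ht; destruct (Hcu t Ht) as [_ [D1 [D2 V]]]).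
    + now apply sqrt_lt_R0.
    + auto.
    + apply (continuous_comp (velocity cu) snd); auto; apply continuous_snd.
    + now apply speed_continuous.
    + apply (rotational_norm_ge E G c (cu t) (velocity cu t)); auto.
Qed.

(** The straight segment is a competitor. *)
Lemma riem_dist_segment_le E G M p q :
  (forall x, 0 <= E x <= M) -> (forall x, 0 <= G x <= M) ->
  (forall x, continuous E x) -> (forall x, continuous G x) ->
  Rbar_le (riem_dist plane (rotational_metric E G) p q)
    (sqrt (M * ((fst q - fst p) ^ 2 + (snd q - snd p) ^ 2))).
Proof.
  intros HE HG CE CG.
  set (cu := fun t : R => (fst p + t * (fst q - fst p), snd p + t * (snd q - snd p))).
  assert (D1 : forall t, is_derive (fun s => fst (cu s)) t (fst q - fst p)).
  { intros t. unfold cu; simpl. auto_derive; auto. ring. }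
  assert (D2 : forall t, is_derive (fun s => snd (cu s)) t (snd q - snd p)).
  { intros t. unfold cu; simpl. auto_derive; auto. ring. }
  assert (V : velocity cu = fun _ => (fst q - fst p, snd q - snd p)).
  { extensionality t. unfold velocity. f_equal; now apply is_derive_unique. }
  assert (Cv : forall t, continuous (velocity cu) t).
  { intros t. rewrite V. apply continuous_const. }
  apply Rbar_le_trans with (curve_length (rotational_metric E G) cu).
  - apply Glb_Rbar_correct. exists cu. split; auto. split; [|split].
    + apply injective_projections; simpl; ring.
    + apply injective_projections; simpl; ring.
    + intros t _. repeat split; auto; eexists; eauto.
  - unfold Rbar_le, curve_length.
    replace (sqrt (M * ((fst q - fst p) ^ 2 + (snd q - snd p) ^ 2)))
      with (RInt (fun _ => sqrt (M * ((fst q - fst p) ^ 2 + (snd q - snd p) ^ 2))) 0 1).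
    2:{ rewrite RInt_const. unfold scal; simpl; unfold mult; simpl. ring. }
    apply RInt_le; [lra | | apply ex_RInt_const |].
    + apply (@ex_RInt_continuous R_CompleteNormedModule). intros t _.
      apply speed_continuous; auto. eexists; apply D1.
    + intros t _. apply sqrt_le_1_alt. rewrite V. unfold rotational_metric, diag_metric. cbn [fst snd].
      specialize (HE (fst (cu t))). specialize (HG (fst (cu t))).
      assert (0 <= (fst q - fst p) ^ 2) by apply pow2_ge_0.
      assert (0 <= (snd q - snd p) ^ 2) by apply pow2_ge_0. nra.
Qed.

Lemma riem_dist_lt D g p q (eps : R) :
  Rbar_lt (riem_dist D g p q) eps ->
  exists cu, C1_curve D p q cu /\ curve_length g cu < eps.
Proof.
  intros H. destruct (excluded_middle_informative
    (exists cu, C1_curve D p q cu /\ curve_length g cu < eps)) as [|N]; auto.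
  exfalso. apply (Rbar_lt_not_le _ _ H).
  apply (proj2 (Glb_Rbar_correct _)). intros L [cu [Hcu ->]]. simpl.
  apply Rnot_lt_le. intros Hl. apply N. now exists cu.
Qed.

(** The distance is equivalent to the Euclidean one: Cauchy sequences are Cauchy in each
    coordinate by [curve_length_ge], and coordinatewise convergence is convergence for the
    distance by [riem_dist_segment_le]. *)
Lemma complete_rotational E G c M :
  0 < c -> (forall x, c <= E x <= M) -> (forall x, c <= G x <= M) ->
  (forall x, continuous E x) -> (forall x, continuous G x) ->
  complete_metric plane (rotational_metric E G).
Proof.
  intros Hc HE HG CE CG u _ Hu.
  assert (Hsc : 0 < sqrt c) by now apply sqrt_lt_R0.
  assert (HM : 0 < M) by (specialize (HE 0); lra).
  assert (B : forall eps, 0 < eps -> exists N, forall m n, (N <= m)%nat -> (N <= n)%nat ->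
     Rabs (fst (u n) - fst (u m)) < eps /\ Rabs (snd (u n) - snd (u m)) < eps).
  { intros eps He. destruct (Hu (sqrt c * eps)) as [N HN]; [nra|].
    exists N. intros m n Hm Hn.
    destruct (riem_dist_lt _ _ _ _ _ (HN m n Hm Hn)) as [cu [Hcu Hl]].
    destruct (curve_length_ge E G c (u m) (u n) cu Hc (fun x => proj1 (HE x))
      (fun x => proj1 (HG x)) CE CG Hcu) as [L1 L2].
    split; apply Rmult_lt_reg_l with (sqrt c); lra. }
  destruct (Rcomplete.R_complete (fun n => fst (u n))) as [a Ha].
  { intros eps He. destruct (B eps He) as [N HN]. exists N. intros n m Hn Hm.
    unfold R_dist. apply HN; auto. }
  destruct (Rcomplete.R_complete (fun n => snd (u n))) as [b Hb].
  { intros eps He. destruct (B eps He) as [N HN]. exists N. intros n m Hn Hm.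
    unfold R_dist. apply HN; auto. }
  exists (a, b). split; [exact I|].
  intros eps He.
  (* Both coordinate differences are below [d], so the segment is shorter than [sqrt (2 M d^2)]. *)
  assert (HM2 : 0 < sqrt (2 * M)) by (apply sqrt_lt_R0; lra).
  set (d := eps / sqrt (2 * M)).
  assert (Hd : 0 < d) by now apply Rdiv_lt_0_compat.
  destruct (Ha d Hd) as [N1 H1]. destruct (Hb d Hd) as [N2 H2].
  exists (max N1 N2). intros n Hn.
  specialize (H1 n ltac:(lia)). specialize (H2 n ltac:(lia)). unfold R_dist in H1, H2.
  apply Rbar_le_lt_trans with (1 := riem_dist_segment_le E G M (u n) (a, b)
    ltac:(intros x; specialize (HE x); lra) ltac:(intros x; specialize (HG x); lra) CE CG).
  unfold Rbar_lt. cbn [fst snd].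
  replace eps with (sqrt (2 * M * d ^ 2)).
  2:{ rewrite sqrt_mult_alt, sqrt_pow2 by lra. unfold d. field. lra. }
  apply sqrt_lt_1_alt.
  rewrite <- (pow2_abs (a - fst (u n))), <- (pow2_abs (b - snd (u n))).
  rewrite (Rabs_minus_sym a), (Rabs_minus_sym b).
  set (r1 := Rabs (fst (u n) - a)) in *. set (r2 := Rabs (snd (u n) - b)) in *.
  assert (0 <= r1) by apply Rabs_pos. assert (0 <= r2) by apply Rabs_pos.
  assert (r1 ^ 2 < d ^ 2) by nra. assert (r2 ^ 2 < d ^ 2) by nra.
  split; [|nra]. apply Rmult_le_pos; nra.
Qed.

(** * Simple connectedness of the plane *)

Lemma filterlim_homotopy {S : Type} (Fl : (S -> Prop) -> Prop) (f g : S -> R) (c : S -> R) a b d :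
  Filter Fl -> filterlim f Fl (locally a) -> filterlim g Fl (locally b) ->
  filterlim c Fl (locally d) ->
  filterlim (fun s => (1 - c s) * f s + c s * g s) Fl (locally ((1 - d) * a + d * b)).
Proof.
  intros FF Hf Hg Hc.
  apply (filterlim_comp_2 (G := locally ((1 - d) * a)) (H := locally (d * b))
    (fun s => (1 - c s) * f s) (fun s => c s * g s) Rplus).
  - apply (filterlim_comp_2 (G := locally (1 - d)) (H := locally a) (fun s => 1 - c s) f Rmult); auto.
    + apply filterlim_comp with (2 := continuous_minus (fun _ => 1) (fun x : R => x) d (continuous_const _ _) (continuous_id _)); auto.
    + apply (filterlim_mult (K := R_AbsRing)).
  - apply (filterlim_comp_2 (G := locally d) (H := locally b) c g Rmult); auto.
    apply (filterlim_mult (K := R_AbsRing)).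
  - apply (filterlim_plus (V := R_NormedModule)).
Qed.

Lemma filterlim_couple {S : Type} (Fl : (S -> Prop) -> Prop) (f g : S -> R) (p : R * R) :
  Filter Fl -> filterlim f Fl (locally (fst p)) -> filterlim g Fl (locally (snd p)) ->
  filterlim (fun s => (f s, g s)) Fl (locally p).
Proof.
  intros FF Hf Hg. apply filterlim_locally. intros eps.
  pose proof (proj1 (filterlim_locally f (fst p)) Hf eps) as H1.
  pose proof (proj1 (filterlim_locally g (snd p)) Hg eps) as H2.
  generalize (filter_and _ _ H1 H2). apply filter_imp. intros s [A B]. split; assumption.
Qed.

(** The plane is convex: segments are paths, and the straight-line homotopy contracts loops. *)
Lemma simply_connected_plane :
  simply_connected (prod_UniformSpace R_UniformSpace R_UniformSpace).
Proof.
  assert (fstc : forall p : R * R, filterlim fst (locally p) (locally (fst p)))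
    by (intros [a b]; apply (continuous_fst a b)).
  assert (sndc : forall p : R * R, filterlim snd (locally p) (locally (snd p)))
    by (intros [a b]; apply (continuous_snd a b)).
  split; [|split].
  - now exists (0, 0).
  - intros x y.
    exists (fun t => ((1 - t) * fst x + t * fst y, (1 - t) * snd x + t * snd y)).
    split; [|split].
    + intros t _. apply filterlim_filter_le_1 with (1 := filter_le_within _).
      apply (filterlim_couple _ _ _ ((1 - t) * fst x + t * fst y, (1 - t) * snd x + t * snd y)).
      * apply locally_filter.
      * apply (filterlim_homotopy _ (fun _ => fst x) (fun _ => fst y) (fun t => t));
          try apply locally_filter; try apply filterlim_id; apply filterlim_const.
      * apply (filterlim_homotopy _ (fun _ => snd x) (fun _ => snd y) (fun t => t));
          try apply locally_filter; try apply filterlim_id; apply filterlim_const.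
    + apply injective_projections; simpl; ring.
    + apply injective_projections; simpl; ring.
  - intros x c [Hc [H0 H1]].
    exists (fun ts => ((1 - snd ts) * fst (c (fst ts)) + snd ts * fst x,
                       (1 - snd ts) * snd (c (fst ts)) + snd ts * snd x)).
    split; [|split].
    + intros ts Hts.
      set (Fl := within (fun ts : R * R => unit_interval (fst ts) /\ unit_interval (snd ts)) (locally ts)).
      assert (FF : Filter Fl) by (apply within_filter, locally_filter).
      assert (Ct : filterlim (fun ts => c (fst ts)) Fl (locally (c (fst ts)))).
      { apply filterlim_comp with (2 := Hc (fst ts) (proj1 Hts)).
        intros P HP. unfold within, filtermap in *.
        pose proof (fstc ts _ HP) as HQ. unfold filtermap in HQ. unfold Fl, within. revert HQ. apply filter_imp.
        intros z Hz [K _]. apply Hz, K. }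
      assert (Cs : filterlim snd Fl (locally (snd ts))).
      { apply filterlim_filter_le_1 with (1 := filter_le_within _). apply sndc. }
      apply (filterlim_couple _ _ _ ((1 - snd ts) * fst (c (fst ts)) + snd ts * fst x,
                       (1 - snd ts) * snd (c (fst ts)) + snd ts * snd x)); auto.
      * apply (filterlim_homotopy _ (fun ts => fst (c (fst ts))) (fun _ => fst x) snd); auto;
          try apply filterlim_const. apply filterlim_comp with (1 := Ct). apply fstc.
      * apply (filterlim_homotopy _ (fun ts => snd (c (fst ts))) (fun _ => snd x) snd); auto;
          try apply filterlim_const. apply filterlim_comp with (1 := Ct). apply sndc.
    + intros t _. split; apply injective_projections; simpl; ring.
    + intros s _. cbn [fst snd]. rewrite H0, H1. split; apply injective_projections; simpl; ring.
Qed.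

(** * Angles *)

Lemma IZR_nat_or_opp k : exists n, IZR k = INR n \/ IZR k = - INR n.
Proof.
  exists (Z.to_nat (Z.abs k)). rewrite INR_IZR_INZ, Z2Nat.id by lia.
  destruct (Z.abs_eq_or_opp k) as [E|E]; rewrite E; [left|right]; auto.
  rewrite opp_IZR. ring.
Qed.

Lemma cos_period_Z x k : cos (x + 2 * IZR k * PI) = cos x.
Proof.
  destruct (IZR_nat_or_opp k) as [n [E|E]]; rewrite E.
  - apply cos_period.
  - rewrite <- (cos_period _ n). f_equal. ring.
Qed.

Lemma sin_period_Z x k : sin (x + 2 * IZR k * PI) = sin x.
Proof.
  destruct (IZR_nat_or_opp k) as [n [E|E]]; rewrite E.
  - apply sin_period.
  - rewrite <- (sin_period _ n). f_equal. ring.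
Qed.

Lemma exists_period_translate d : exists k : Z, - PI <= d - 2 * IZR k * PI < PI.
Proof.
  pose proof PI_RGT_0 as HP.
  exists (up (d / (2 * PI) - / 2)).
  destruct (archimed (d / (2 * PI) - / 2)) as [A B].
  set (n := IZR (up (d / (2 * PI) - / 2))) in *.
  set (q := d / (2 * PI)) in *.
  replace d with (q * (2 * PI)) by (unfold q; field; lra).
  split; nra.
Qed.

Lemma cos_pos_sheet d :
  0 < cos d -> exists k : Z, - (PI / 2) < d - 2 * IZR k * PI < PI / 2.
Proof.
  intros H. destruct (exists_period_translate d) as [k Hk]. exists k.
  rewrite <- (cos_period_Z _ (- k)) in H.
  replace (d + 2 * IZR (- k) * PI) with (d - 2 * IZR k * PI) in H by (rewrite opp_IZR; ring).
  set (x := d - 2 * IZR k * PI) in *.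
  split; apply Rnot_le_lt; intros Hx.
  - rewrite <- cos_neg in H. pose proof (cos_le_0 (- x)) as H'. lra.
  - pose proof (cos_le_0 x). lra.
Qed.

Lemma sheet_index_unique (i j : Z) (d : R) :
  - (PI / 2) < d - 2 * IZR i * PI < PI / 2 ->
  - (PI / 2) < d - 2 * IZR j * PI < PI / 2 -> i = j.
Proof.
  intros Hi Hj. pose proof PI_RGT_0 as HP.
  assert (H : forall a b : Z, 2 * (IZR a - IZR b) * PI < PI -> (a <= b)%Z).
  { intros a b Hab. apply Z.lt_succ_r, lt_IZR. rewrite succ_IZR. nra. }
  apply Z.le_antisymm; apply H; lra.
Qed.

(** * Surfaces of revolution *)

(** The angle is divided by [c] so that, for [r = c * w], the induced metric has [w^2] as its
    coefficient in the direction of the angle ([induced_metric_revolve]). *)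
Definition revolve (r : R -> R) (c : R) (p : R * R) : R * R * R :=
  (r (fst p) * cos (snd p / c), r (fst p) * sin (snd p / c), fst p).

Lemma continuous_pair {U : UniformSpace} (f g : U -> R) (x : U) :
  continuous f x -> continuous g x -> continuous (fun y => (f y, g y)) x.
Proof. intros Hf Hg. apply (filterlim_couple _ f g (f x, g x)); auto. apply locally_filter. Qed.

Lemma continuous_Rdiv {U : UniformSpace} (f g : U -> R) (x : U) :
  continuous f x -> continuous g x -> g x <> 0 -> continuous (fun y => f y / g y) x.
Proof.
  intros Hf Hg Hx. apply (continuous_mult f (fun y => / g y)); auto.
  apply (continuous_comp g Rinv); auto. apply continuous_Rinv; auto.
Qed.

Lemma continuous_coord3 (z : R * R * R) :
  continuous (fun z : R * R * R => fst (fst z)) z /\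
  continuous (fun z : R * R * R => snd (fst z)) z /\
  continuous (fun z : R * R * R => snd z) z.
Proof.
  destruct z as [[x y] z]. repeat split.
  - apply (continuous_comp fst fst); apply continuous_fst.
  - apply (continuous_comp fst snd); [apply continuous_fst | apply continuous_snd].
  - apply continuous_snd.
Qed.

(** Over the half-space on which the component along the horizontal direction of angle [t0 / c]
    is positive, the angle of a point is determined modulo [2 PI] by an arctangent; the choices
    of the multiple of [2 PI] index the sheets. *)
Lemma covering_revolve (r : R -> R) (c : R) :
  0 < c -> (forall x, 0 < r x) -> (forall x, continuous r x) ->
  covering_map (revolve r c) (fun z => exists p, revolve r c p = z).
Proof.
  intros Hc Hr Cr. pose proof PI_RGT_0 as HP.
  assert (Cfst : forall p : R * R, continuous fst p) by (intros [a b]; apply continuous_fst).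
  assert (Csnd : forall p : R * R, continuous snd p) by (intros [a b]; apply continuous_snd).
  assert (Cang : forall p : R * R, continuous (fun p : R * R => snd p / c) p).
  { intros p. apply continuous_Rdiv; auto. apply continuous_const. lra. }
  assert (Crad : forall p : R * R, continuous (fun p : R * R => r (fst p)) p).
  { intros p. apply (continuous_comp fst r); auto. }
  split; [|split; [|split]].
  - intros p. unfold revolve.
    assert (C1 : continuous (fun p : R * R => r (fst p) * cos (snd p / c)) p).
    { apply (continuous_mult (fun p : R * R => r (fst p))); auto.
      apply (continuous_comp (fun p : R * R => snd p / c) cos); auto. apply continuous_cos. }
    assert (C2 : continuous (fun p : R * R => r (fst p) * sin (snd p / c)) p).
    { apply (continuous_mult (fun p : R * R => r (fst p))); auto.
      apply (continuous_comp (fun p : R * R => snd p / c) sin); auto. apply continuous_sin. }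
    apply filterlim_locally. intros eps.
    pose proof (proj1 (filterlim_locally _ _) C1 eps) as B1.
    pose proof (proj1 (filterlim_locally _ _) C2 eps) as B2.
    pose proof (proj1 (filterlim_locally _ _) (Cfst p) eps) as B3.
    generalize (filter_and _ _ B1 (filter_and _ _ B2 B3)).
    apply filter_imp. intros q [K1 [K2 K3]]. repeat split; assumption.
  - intros p. now exists p.
  - auto.
  - intros y [[h0 t0] <-]. set (a0 := t0 / c).
    set (den := fun z : R * R * R => fst (fst z) * cos a0 + snd (fst z) * sin a0).
    set (num := fun z : R * R * R => snd (fst z) * cos a0 - fst (fst z) * sin a0).
    assert (Hden : forall p, den (revolve r c p) = r (fst p) * cos (snd p / c - a0)).
    { intros p. unfold den, revolve; cbn [fst snd]. rewrite cos_minus. ring. }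
    assert (Hnum : forall p, num (revolve r c p) = r (fst p) * sin (snd p / c - a0)).
    { intros p. unfold num, revolve; cbn [fst snd]. rewrite sin_minus. ring. }
    assert (Cden : forall z, continuous den z).
    { intros z. destruct (continuous_coord3 z) as [K1 [K2 K3]].
      apply (continuous_plus (fun z : R * R * R => fst (fst z) * cos a0) (fun z : R * R * R => snd (fst z) * sin a0));
      apply @continuous_mult; auto; apply continuous_const. }
    assert (Cnum : forall z, continuous num z).
    { intros z. destruct (continuous_coord3 z) as [K1 [K2 K3]].
      apply (continuous_minus (fun z : R * R * R => snd (fst z) * cos a0) (fun z : R * R * R => fst (fst z) * sin a0));
      apply @continuous_mult; auto; apply continuous_const. }
    exists (fun z => 0 < den z). split; [|split].
    + apply (open_comp den (fun x => 0 < x)); [intros z _; apply Cden | apply open_gt].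
    + rewrite Hden. cbn [fst snd]. unfold a0. rewrite Rminus_diag, cos_0. specialize (Hr h0). lra.
    + set (U := fun (k : Z) (p : R * R) => - (PI / 2) < snd p / c - a0 - 2 * IZR k * PI < PI / 2).
      assert (HU : forall p, 0 < den (revolve r c p) <-> exists k, U k p).
      { intros p. rewrite Hden. specialize (Hr (fst p)). split.
        - intros H. apply cos_pos_sheet. nra.
        - intros [k Hk]. apply Rmult_lt_0_compat; auto.
          rewrite <- (cos_period_Z _ (- k)).
          replace (snd p / c - a0 + 2 * IZR (- k) * PI) with (snd p / c - a0 - 2 * IZR k * PI)
            by (rewrite opp_IZR; ring).
          apply cos_gt_0; apply Hk. }
      set (q := fun (k : Z) (z : R * R * R) =>
                  (snd z, t0 + c * (2 * IZR k * PI + atan (num z / den z)))).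
      (* On the sheet [U j] the ratio is the tangent of the angle measured from [a0]. *)
      assert (Hq : forall k j p, U j p ->
                q k (revolve r c p) = (fst p, snd p + c * (2 * (IZR k - IZR j) * PI))).
      { intros k j p Hj. unfold q. rewrite Hnum, Hden.
        assert (Hcos : 0 < den (revolve r c p)) by (apply HU; eauto). rewrite Hden in Hcos.
        pose proof (Hr (fst p)).
        assert (cos (snd p / c - a0) <> 0) by (intros E; rewrite E in Hcos; lra).
        replace (r (fst p) * sin (snd p / c - a0) / (r (fst p) * cos (snd p / c - a0)))
          with (tan (snd p / c - a0 - 2 * IZR j * PI)).
        - rewrite atan_tan by apply Hj. f_equal. unfold a0. field. lra.
        - unfold tan.
          replace (snd p / c - a0 - 2 * IZR j * PI) with (snd p / c - a0 + 2 * IZR (- j) * PI)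
            by (rewrite opp_IZR; ring).
          rewrite sin_period_Z, cos_period_Z. field. split; auto. lra. }
      exists Z, U. split; [|split; [|split]].
      * intros k. apply (open_comp (fun p : R * R => snd p / c - a0 - 2 * IZR k * PI)
                         (fun x => - (PI / 2) < x < PI / 2)); [|exact (open_between (- (PI / 2)) (PI / 2))].
        intros p _. apply @continuous_minus; [|apply continuous_const].
        apply @continuous_minus; [auto|apply continuous_const].
      * intros i j p. apply sheet_index_unique.
      * exact HU.
      * intros k. exists (q k). split; [|split].
        -- intros z [Hz _].
           apply filterlim_filter_le_1 with (1 := filter_le_within _).
           destruct (continuous_coord3 z) as [_ [_ K3]].
           apply (continuous_pair (fun z : R * R * R => snd z)); auto.
           apply @continuous_plus; [apply continuous_const|].
           apply @continuous_mult; [apply continuous_const|].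
           apply @continuous_plus; [apply continuous_const|].
           apply (continuous_comp (fun z => num z / den z) atan); [|apply continuous_atan].
           apply continuous_Rdiv; auto. lra.
        -- intros z Hz [p <-]. apply HU in Hz. destruct Hz as [j Hj].
           rewrite (Hq k j p Hj). split.
           ++ unfold U in *. cbn [snd].
              replace ((snd p + c * (2 * (IZR k - IZR j) * PI)) / c - a0 - 2 * IZR k * PI)
                with (snd p / c - a0 - 2 * IZR j * PI) by (field; lra). exact Hj.
           ++ unfold revolve; cbn [fst snd].
              replace ((snd p + c * (2 * (IZR k - IZR j) * PI)) / c)
                with (snd p / c + 2 * IZR (k - j) * PI) by (rewrite minus_IZR; field; lra).
              now rewrite sin_period_Z, cos_period_Z.
        -- intros [h t] Hp. rewrite (Hq k k (h, t) Hp).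
           apply injective_projections; cbn [fst snd]; [reflexivity|].
           apply (Rplus_eq_reg_r (- t)). ring.
Qed.

Lemma Ck_cos_scaled n c : Ck n line (fun t => cos (t / c)).
Proof.
  apply (Ck_comp n line line cos (fun t => t / c)); auto using open_line.
  - apply Ck_sin_cos.
  - apply Ck_mult; auto using open_line, Ck_const, Ck_id.
Qed.

Lemma Ck_sin_scaled n c : Ck n line (fun t => sin (t / c)).
Proof.
  apply (Ck_comp n line line sin (fun t => t / c)); auto using open_line.
  - apply Ck_sin_cos.
  - apply Ck_mult; auto using open_line, Ck_const, Ck_id.
Qed.

Lemma class_C_map3_revolve n r c : Ck n line r -> class_C_map3 n plane (revolve r c).
Proof.
  intros Hr. split; [|split]; cbn [fst snd revolve].
  - apply (class_C_prod n line r (fun t => cos (t / c))); auto using Ck_cos_scaled.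
  - apply (class_C_prod n line r (fun t => sin (t / c))); auto using Ck_sin_scaled.
  - apply (class_C_fst n line (fun x => x)). apply Ck_id, open_line.
Qed.

Lemma induced_metric_revolve r c p u v :
  0 < c -> (forall x, ex_derive r x) ->
  induced_metric (revolve r c) p u v =
  rotational_metric (fun x => 1 + Derive r x ^ 2) (fun x => (r x / c) ^ 2) p u v.
Proof.
  intros Hc Hr. unfold induced_metric, diff, sum_axes, revolve. cbn [fst snd].
  rewrite (partial_ax1_prod r (fun t => cos (t / c))), (partial_ax2_prod r (fun t => cos (t / c))).
  rewrite (partial_ax1_prod r (fun t => sin (t / c))), (partial_ax2_prod r (fun t => sin (t / c))).
  rewrite (partial_fst_ax1 (fun x => x)), (partial_fst_ax2 (fun x => x)).
  assert (Dc : forall t, Derive (fun t => cos (t / c)) t = - sin (t / c) / c).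
  { intros t. apply is_derive_unique. auto_derive; auto. unfold Rdiv. ring. }
  assert (Ds : forall t, Derive (fun t => sin (t / c)) t = cos (t / c) / c).
  { intros t. apply is_derive_unique. auto_derive; auto. unfold Rdiv. ring. }
  rewrite Dc, Ds, Derive_id. cbn [coord]. unfold rotational_metric, diag_metric.
  set (t := snd p / c). pose proof (sin2_cos2 t) as H. unfold Rsqr in H.
  set (S := sin t) in *. set (K := cos t) in *.
  set (r' := Derive r (fst p)). set (r0 := r (fst p)).
  replace (1 + r' ^ 2) with (1 + r' ^ 2 * (S * S + K * K)) by (rewrite H; ring).
  replace ((r0 / c) ^ 2) with ((r0 / c) ^ 2 * (S * S + K * K)) by (rewrite H; ring).
  field. lra.
Qed.

(** * The quartic and its factorization *)

(** The function [T] in the variable [y = xi^(2/3)], see [T_pow32]. *)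
Definition quartic (C y : R) : R := - y ^ 4 + 3 * C * y ^ 3 - 3.

Definition cofactor (b c y : R) : R := y ^ 2 + b * y + c.

Lemma Rpower_half_int y n : 0 < y -> Rpower y (INR n + / 2) = y ^ n * sqrt y.
Proof. intros Hy. now rewrite Rpower_plus, Rpower_pow, Rpower_sqrt. Qed.

Lemma Rpower_3_2 y : 0 < y -> Rpower y (3 / 2) = y * sqrt y.
Proof.
  intros Hy. replace (3 / 2) with (INR 1 + / 2) by (simpl; lra).
  rewrite Rpower_half_int by auto. ring.
Qed.

Lemma pow32_pos y : 0 < y -> 0 < y * sqrt y.
Proof. intros H. apply Rmult_lt_0_compat; auto. now apply sqrt_lt_R0. Qed.

Lemma pow32_lt y z : 0 < y -> y < z -> y * sqrt y < z * sqrt z.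
Proof.
  intros Hy Hz. pose proof (sqrt_lt_R0 y Hy). pose proof (sqrt_lt_1_alt y z ltac:(lra)). nra.
Qed.

Lemma pow32_sqr y : 0 < y -> (y * sqrt y) ^ 2 = y ^ 3.
Proof. intros H. rewrite Rpow_mult_distr, pow2_sqrt by lra. ring. Qed.

Lemma pow32_Rpower x : 0 < x -> Rpower x (2 / 3) * sqrt (Rpower x (2 / 3)) = x.
Proof.
  intros Hx. rewrite <- Rpower_3_2 by apply exp_pos. rewrite Rpower_mult.
  replace (2 / 3 * (3 / 2)) with 1 by field. now apply Rpower_1.
Qed.

Lemma Rpower_pow32 y : 0 < y -> Rpower (y * sqrt y) (2 / 3) = y.
Proof.
  intros Hy. rewrite <- Rpower_3_2 by auto. rewrite Rpower_mult.
  replace (3 / 2 * (2 / 3)) with 1 by field. now apply Rpower_1.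
Qed.

Lemma T_pow32 C y : 0 < y -> T C (y * sqrt y) = quartic C y.
Proof.
  intros Hy. unfold T, quartic. rewrite pow32_sqr by auto.
  rewrite <- Rpower_3_2 by auto. rewrite Rpower_mult.
  replace (3 / 2 * (8 / 3)) with (INR 4) by (simpl; field). rewrite Rpower_pow by auto. ring.
Qed.

(** The value of [C] at which the quartic has a double root. *)
Definition C_crit : R := 4 / Rpower 3 (3 / 2).

Lemma C_crit_eq : C_crit = 4 / (3 * sqrt 3).
Proof. unfold C_crit. rewrite Rpower_3_2 by lra. reflexivity. Qed.

Lemma C_crit_pos : 0 < C_crit.
Proof. unfold C_crit. apply Rdiv_lt_0_compat; [lra | apply exp_pos]. Qed.

(** Dividing by [3 y^3], this says that [y / 3 + 1 / y^3 >= C_crit]; equality holds at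
    [y = sqrt 3], and with [y = sqrt 3 t] the difference of the two sides is a multiple of
    [(t - 1)^2 (3 t^2 + 2 t + 1)]. *)
Lemma quartic_le C y : 0 < y -> quartic C y <= 3 * (C - C_crit) * y ^ 3.
Proof.
  intros Hy. rewrite C_crit_eq. unfold quartic.
  pose proof (sqrt_lt_R0 3 ltac:(lra)) as Hs. pose proof (sqrt_sqrt 3 ltac:(lra)) as Hss.
  set (s := sqrt 3) in *.
  set (t := y / s). assert (Ht : 0 < t) by now apply Rdiv_lt_0_compat.
  replace y with (s * t) by (unfold t; field; lra).
  replace (3 * (C - 4 / (3 * s)) * (s * t) ^ 3) with (3 * C * (s * t) ^ 3 - 4 * (s * s) * t ^ 3)
    by (field; lra).
  replace ((s * t) ^ 4) with ((s * s) * (s * s) * t ^ 4) by ring. rewrite Hss.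
  assert (0 <= (t - 1) ^ 2 * (3 * t ^ 2 + 2 * t + 1)) by (apply Rmult_le_pos; [apply pow2_ge_0 | nra]).
  nra.
Qed.

(** The intermediate point [9 / 4 * C] is the value of [y] at [xi00], where the quartic is maximal. *)
Record quartic_factorization (C : R) := {
  ymin : R; ymax : R; lin : R; cst : R;
  ymin_pos : 0 < ymin;
  ymin_lt : ymin < 9 / 4 * C;
  ymax_gt : 9 / 4 * C < ymax;
  lin_pos : 0 < lin;
  cst_pos : 0 < cst;
  quartic_factor : forall y, quartic C y = (y - ymin) * (ymax - y) * cofactor lin cst y
}.

Arguments ymin {C}. Arguments ymax {C}. Arguments lin {C}. Arguments cst {C}.
Arguments ymin_pos {C}. Arguments ymin_lt {C}. Arguments ymax_gt {C}.
Arguments lin_pos {C}. Arguments cst_pos {C}. Arguments quartic_factor {C}.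

Lemma quartic_max_pos C : C_crit < C -> 0 < quartic C (9 / 4 * C).
Proof.
  intros HC. rewrite C_crit_eq in HC. unfold quartic.
  pose proof (sqrt_lt_R0 3 ltac:(lra)) as Hs. pose proof (sqrt_sqrt 3 ltac:(lra)) as Hss.
  set (s := sqrt 3) in *.
  assert (H1 : 4 < C * (3 * s)).
  { apply Rmult_lt_reg_r with (/ (3 * s)).
    - apply Rinv_0_lt_compat. lra.
    - rewrite Rmult_assoc, Rinv_r by lra. unfold Rdiv in HC. lra. }
  assert (HC0 : 0 < C) by nra.
  assert (H2 : 16 < 27 * C ^ 2).
  { replace (27 * C ^ 2) with ((C * (3 * s)) * (C * (3 * s))).
    - nra.
    - replace (C * (3 * s) * (C * (3 * s))) with (9 * C ^ 2 * (s * s)) by ring. rewrite Hss. ring. }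
  assert (H3 : 256 < 729 * C ^ 4) by nra.
  replace (- (9 / 4 * C) ^ 4 + 3 * C * (9 / 4 * C) ^ 3 - 3) with (3 * (729 * C ^ 4 / 256 - 1)) by field.
  lra.
Qed.

(** The roots come from the intermediate value theorem on [0, 9C/4] and [9C/4, 3C]. Dividing
    by them leaves an affine remainder that vanishes at two points; its two coefficients, being
    zero, determine the signs of the remaining quadratic factor. *)
Lemma quartic_factorization_exists C : C_crit < C -> inhabited (quartic_factorization C).
Proof.
  intros HC. pose proof (quartic_max_pos C HC) as Hm. pose proof C_crit_pos as Hc0.
  assert (Cq : forall y, continuity_pt (quartic C) y).
  { intros y. apply continuity_pt_filterlim. apply @ex_derive_continuous.
    unfold quartic. auto_derive; auto. }
  destruct (IVT_gen (quartic C) 0 (9 / 4 * C) 0 Cq) as [y1 [B1 E1]].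
  { replace (quartic C 0) with (-3) by (unfold quartic; ring).
    rewrite Rmin_left, Rmax_right; lra. }
  destruct (IVT_gen (quartic C) (9 / 4 * C) (3 * C) 0 Cq) as [y2 [B2 E2]].
  { replace (quartic C (3 * C)) with (-3) by (unfold quartic; ring).
    rewrite Rmin_right, Rmax_left; lra. }
  rewrite Rmin_left, Rmax_right in B1, B2 by lra.
  assert (N1 : y1 <> 0) by (intros ->; unfold quartic in E1; lra).
  assert (N2 : y1 <> 9 / 4 * C) by (intros ->; lra).
  assert (N3 : y2 <> 9 / 4 * C) by (intros ->; lra).
  set (S := y1 + y2). set (P := y1 * y2). set (b := S - 3 * C). set (c := S * b - P).
  (* The remainder of the division by [(y - y1) (y2 - y)] is [(S c - P b) y + (3 - P c)]. *)
  assert (K1 : (S * c - P * b) * y1 + (3 - P * c) = 0).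
  { rewrite <- Ropp_0, <- E1. unfold quartic, c, b, S, P. ring. }
  assert (K2 : (S * c - P * b) * y2 + (3 - P * c) = 0).
  { rewrite <- Ropp_0, <- E2. unfold quartic, c, b, S, P. ring. }
  assert (Ka : S * c - P * b = 0).
  { assert ((S * c - P * b) * (y2 - y1) = 0) as K by lra.
    apply Rmult_integral in K. destruct K; lra. }
  assert (Kb : 3 - P * c = 0) by (rewrite Ka in K1; lra).
  assert (HP : 0 < P) by (unfold P; apply Rmult_lt_0_compat; lra).
  assert (HS : 0 < S) by (unfold S; lra).
  assert (Hc : 0 < c) by (apply Rmult_lt_reg_l with P; lra).
  assert (Hb : 0 < b).
  { apply Rmult_lt_reg_l with P; auto. pose proof (Rmult_lt_0_compat _ _ HS Hc). lra. }
  constructor. refine (Build_quartic_factorization C y1 y2 b c _ _ _ Hb Hc _); try lra.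
  intros y.
  replace (quartic C y) with (quartic C y + ((S * c - P * b) * y + (3 - P * c))) by (rewrite Ka, Kb; ring).
  unfold quartic, cofactor, c, b, S, P. ring.
Qed.

Lemma quartic_factor_derive C (q : quartic_factorization C) y :
  - 4 * y ^ 3 + 9 * C * y ^ 2 =
  (ymin q + ymax q - 2 * y) * cofactor (lin q) (cst q) y
  + (y - ymin q) * (ymax q - y) * (2 * y + lin q).
Proof.
  assert (D1 : is_derive (quartic C) y (- 4 * y ^ 3 + 9 * C * y ^ 2))
    by (unfold quartic; auto_derive; auto; ring).
  apply is_derive_unique in D1. rewrite <- D1.
  rewrite (Derive_ext _ _ y (quartic_factor q)). apply is_derive_unique.
  unfold cofactor. auto_derive; auto. ring.
Qed.

(** * Uniformization of the profile *)

Section Profile.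

Variable C : R.
Variable q : quartic_factorization C.

(* The sign conditions are put in the context for [lra] and [nra]. *)
Let ymin_pos_q := ymin_pos q.
Let ymin_lt_q := ymin_lt q.
Let ymax_gt_q := ymax_gt q.
Let lin_pos_q := lin_pos q.
Let cst_pos_q := cst_pos q.

Lemma ymin_lt_ymax : ymin q < ymax q.
Proof. lra. Qed.

Lemma cofactor_pos y : 0 < y -> 0 < cofactor (lin q) (cst q) y.
Proof. intros Hy. unfold cofactor. nra. Qed.

Lemma quartic_root y : 0 < y -> quartic C y = 0 -> y = ymin q \/ y = ymax q.
Proof.
  intros Hy E. rewrite (quartic_factor q) in E. pose proof (cofactor_pos y Hy).
  apply Rmult_integral in E. destruct E as [E|E]; [|lra].
  apply Rmult_integral in E. destruct E; lra.
Qed.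

Lemma T_root a : 0 < a -> T C a = 0 ->
  a = ymin q * sqrt (ymin q) \/ a = ymax q * sqrt (ymax q).
Proof.
  intros Ha E. rewrite <- (pow32_Rpower a Ha) in *.
  rewrite T_pow32 in E by apply exp_pos.
  destruct (quartic_root _ (exp_pos _) E) as [H|H]; unfold Rpower in *; rewrite H; auto.
Qed.

Lemma T_ymin : T C (ymin q * sqrt (ymin q)) = 0.
Proof. rewrite T_pow32 by lra. rewrite (quartic_factor q). ring. Qed.

Lemma T_ymax : T C (ymax q * sqrt (ymax q)) = 0.
Proof. rewrite T_pow32 by lra. rewrite (quartic_factor q). ring. Qed.

Lemma T_root_pair a b : 0 < a < b -> T C a = 0 -> T C b = 0 ->
  a = ymin q * sqrt (ymin q) /\ b = ymax q * sqrt (ymax q).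
Proof.
  intros Hab Ha Hb. pose proof (pow32_lt (ymin q) (ymax q) ymin_pos_q ymin_lt_ymax).
  destruct (T_root a ltac:(lra) Ha), (T_root b ltac:(lra) Hb); split; lra.
Qed.

Lemma xi01_eq : xi01 C = ymin q * sqrt (ymin q).
Proof.
  apply (iota_unique (V := R_CompleteNormedModule)).
  - intros a [b [Hab [Ha Hb]]]. now apply (T_root_pair a b).
  - exists (ymax q * sqrt (ymax q)). split; [split|split]; auto using T_ymin, T_ymax.
    + now apply pow32_pos.
    + apply pow32_lt; auto using ymin_lt_ymax.
Qed.

Lemma xi02_eq : xi02 C = ymax q * sqrt (ymax q).
Proof.
  apply (iota_unique (V := R_CompleteNormedModule)).
  - intros b [a [Hab [Ha Hb]]]. now apply (T_root_pair a b).
  - exists (ymin q * sqrt (ymin q)). split; [split|split]; auto using T_ymin, T_ymax.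
    + now apply pow32_pos.
    + apply pow32_lt; auto using ymin_lt_ymax.
Qed.

Definition ymid : R := (ymin q + ymax q) / 2.
Definition yamp : R := (ymax q - ymin q) / 2.

Lemma yamp_pos : 0 < yamp.
Proof. unfold yamp. lra. Qed.

(** The sine parametrizes the interval [ymin, ymax] so that
    [(y - ymin) (ymax - y) = (yamp * cos t)^2]. *)
Definition ypar (t : R) : R := ymid + yamp * sin t.
Definition xipar (t : R) : R := ypar t * sqrt (ypar t).
Definition kpar (t : R) : R := sqrt (cofactor (lin q) (cst q) (ypar t)).

Lemma ypar_bounds t : ymin q <= ypar t <= ymax q.
Proof.
  pose proof (SIN_bound t). unfold ypar, ymid, yamp.
  assert (0 < ymax q - ymin q) by lra. split; nra.
Qed.

Lemma ypar_pos t : 0 < ypar t.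
Proof. pose proof (ypar_bounds t). lra. Qed.

Lemma xipar_pos t : 0 < xipar t.
Proof. apply pow32_pos, ypar_pos. Qed.

Lemma kpar_pos t : 0 < kpar t.
Proof. apply sqrt_lt_R0, cofactor_pos, ypar_pos. Qed.

Lemma kpar_sqr t : kpar t ^ 2 = cofactor (lin q) (cst q) (ypar t).
Proof. apply pow2_sqrt, Rlt_le, cofactor_pos, ypar_pos. Qed.

(** The point of the parametrization: [T] has become the square of a smooth function. *)
Lemma quartic_ypar t : quartic C (ypar t) = (yamp * cos t * kpar t) ^ 2.
Proof.
  rewrite (quartic_factor q), Rpow_mult_distr, kpar_sqr. f_equal.
  pose proof (sin2_cos2 t) as H. unfold Rsqr in H.
  replace ((yamp * cos t) ^ 2) with (yamp ^ 2 * (cos t * cos t)) by ring.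
  replace (cos t * cos t) with (1 - sin t * sin t) by lra.
  unfold ypar, ymid, yamp. field.
Qed.

Lemma xipar_eq s t : sin s = sin t -> xipar s = xipar t.
Proof. intros H. unfold xipar, ypar. now rewrite H. Qed.

Lemma xipar_lt s t : sin s < sin t -> xipar s < xipar t.
Proof.
  intros H. apply pow32_lt; [apply ypar_pos|]. unfold ypar. pose proof yamp_pos. nra.
Qed.

Lemma xipar_bot : xipar (- (PI / 2)) = xi01 C.
Proof.
  rewrite xi01_eq. unfold xipar. replace (ypar (- (PI / 2))) with (ymin q); auto.
  unfold ypar. rewrite sin_neg, sin_PI2. unfold ymid, yamp. field.
Qed.

Lemma xipar_top : xipar (PI / 2) = xi02 C.
Proof.
  rewrite xi02_eq. unfold xipar. replace (ypar (PI / 2)) with (ymax q); auto.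
  unfold ypar. rewrite sin_PI2. unfold ymid, yamp. field.
Qed.

Lemma xipar_range t : - (PI / 2) < t < PI / 2 -> xi01 C < xipar t < xi02 C.
Proof.
  intros Ht. rewrite <- xipar_bot, <- xipar_top. pose proof PI_RGT_0.
  split; apply xipar_lt; apply sin_increasing_1; lra.
Qed.

(** The inverse of [xipar] on the principal interval between [- PI / 2] and [PI / 2]. *)
Definition phase (x : R) : R := asin ((Rpower x (2 / 3) - ymid) / yamp).

Lemma phase_arg x : xi01 C < x < xi02 C -> -1 < (Rpower x (2 / 3) - ymid) / yamp < 1.
Proof.
  intros Hx. rewrite xi01_eq, xi02_eq in Hx. pose proof yamp_pos as Hr.
  pose proof (pow32_pos (ymin q) ymin_pos_q).
  assert (Hy : ymin q < Rpower x (2 / 3) < ymax q).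
  { rewrite <- (Rpower_pow32 (ymin q)) at 1 by lra. rewrite <- (Rpower_pow32 (ymax q)) by lra.
    split; apply Rlt_Rpower_l; lra. }
  split; apply Rmult_lt_reg_r with yamp; auto; unfold Rdiv; rewrite Rmult_assoc, Rinv_l by lra;
    unfold ymid, yamp; lra.
Qed.

Lemma phase_range x : xi01 C < x < xi02 C -> - (PI / 2) < phase x < PI / 2.
Proof. intros Hx. apply asin_bound_lt. now apply phase_arg. Qed.

Lemma xipar_phase x : xi01 C < x < xi02 C -> xipar (phase x) = x.
Proof.
  intros Hx. pose proof (phase_arg x Hx). unfold xipar.
  assert (Hx0 : 0 < x). { rewrite xi01_eq in Hx. pose proof (pow32_pos (ymin q) ymin_pos_q). lra. }
  replace (ypar (phase x)) with (Rpower x (2 / 3)).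
  - now apply pow32_Rpower.
  - unfold ypar, phase. rewrite sin_asin by lra. field. pose proof yamp_pos. lra.
Qed.

Lemma phase_xipar t : - (PI / 2) <= t <= PI / 2 -> phase (xipar t) = t.
Proof.
  intros Ht. unfold phase, xipar. rewrite Rpower_pow32 by apply ypar_pos.
  replace ((ypar t - ymid) / yamp) with (sin t).
  - now apply asin_sin.
  - unfold ypar. field. pose proof yamp_pos. lra.
Qed.

Lemma xipar_phase_start : xipar (phase (xi00 C)) = xi00 C /\ - (PI / 2) < phase (xi00 C) < PI / 2.
Proof.
  assert (H : xi01 C < xi00 C < xi02 C).
  { rewrite xi01_eq, xi02_eq. unfold xi00. rewrite Rpower_3_2 by lra.
    split; apply pow32_lt; lra. }
  split; [now apply xipar_phase | now apply phase_range].
Qed.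

Lemma Ck_ypar n : Ck n line ypar.
Proof.
  apply Ck_plus; auto using open_line, Ck_const.
  apply Ck_mult; auto using open_line, Ck_const. apply Ck_sin_cos.
Qed.

Lemma Ck_sqrt_ypar n : Ck n line (fun t => sqrt (ypar t)).
Proof. apply Ck_sqrt_comp; auto using open_line, Ck_ypar. intros; apply ypar_pos. Qed.

Lemma Ck_xipar n : Ck n line xipar.
Proof. apply Ck_mult; auto using open_line, Ck_ypar, Ck_sqrt_ypar. Qed.

Lemma Ck_kpar n : Ck n line kpar.
Proof.
  apply Ck_sqrt_comp; auto using open_line.
  - intros. apply cofactor_pos, ypar_pos.
  - unfold cofactor. apply Ck_plus; auto using open_line, Ck_const.
    apply Ck_plus; auto using open_line.
    + apply Ck_pow; auto using open_line, Ck_ypar.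
    + apply Ck_mult; auto using open_line, Ck_ypar, Ck_const.
Qed.

(** The derivative of arc length: along the profile [(d xi / ds)^2 = xi^2 T / 3], that is
    [(dy / ds)^2 = 4 y^2 T / 27]. *)
Definition arc_density (t : R) : R := 3 * sqrt 3 / 2 / (ypar t * kpar t).

Lemma sqrt3_pos : 0 < sqrt 3.
Proof. apply sqrt_lt_R0. lra. Qed.

Lemma arc_density_pos t : 0 < arc_density t.
Proof.
  pose proof sqrt3_pos. apply Rdiv_lt_0_compat; [lra|].
  apply Rmult_lt_0_compat; [apply ypar_pos | apply kpar_pos].
Qed.

Lemma Ck_arc_density n : Ck n line arc_density.
Proof.
  apply Ck_div; auto using open_line, Ck_const.
  - intros t _. apply Rmult_lt_0_compat; [apply ypar_pos | apply kpar_pos].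
  - apply Ck_mult; auto using open_line, Ck_ypar, Ck_kpar.
Qed.

Lemma arc_density_lower : exists k, 0 < k /\ forall t, k <= arc_density t.
Proof.
  set (k2 := sqrt (cofactor (lin q) (cst q) (ymax q))).
  assert (Hk2 : 0 < k2) by (apply sqrt_lt_R0, cofactor_pos; lra).
  pose proof sqrt3_pos as H3.
  exists (3 * sqrt 3 / 2 / (ymax q * k2)). split.
  - apply Rdiv_lt_0_compat; [lra|]. apply Rmult_lt_0_compat; lra.
  - intros t. apply Rmult_le_compat_l; [lra|]. pose proof (ypar_bounds t) as Hy.
    pose proof (kpar_pos t). pose proof (ypar_pos t).
    apply Rinv_le_contravar; [nra|]. apply Rmult_le_compat; try lra.
    apply sqrt_le_1_alt. unfold cofactor. nra.
Qed.

(** The coefficient of the metric in the direction of [theta] is [wpar^2]. *)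
Definition wpar (t : R) : R := / xipar t.
(** The derivative of [wpar] with respect to arc length. *)
Definition vpar (t : R) : R := - (yamp * cos t * kpar t) / (sqrt 3 * xipar t).
(** The second derivative of [wpar] with respect to arc length. *)
Definition apar (t : R) : R := / xipar t * (ypar t ^ 4 / 9 - 1).

Lemma is_derive_ypar t : is_derive ypar t (yamp * cos t).
Proof. unfold ypar. auto_derive; auto. ring. Qed.

Lemma is_derive_xipar t : is_derive xipar t (3 / 2 * sqrt (ypar t) * (yamp * cos t)).
Proof.
  unfold xipar. pose proof (ypar_pos t) as Hy. pose proof (sqrt_lt_R0 _ Hy).
  pose proof (is_derive_ypar t) as Hd.
  auto_derive.
  - repeat split; try (eexists; exact Hd); auto.
  - change (Derive (fun x => ypar x) t) with (Derive ypar t).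
    rewrite (is_derive_unique _ _ _ Hd).
    pose proof (sqrt_sqrt (ypar t) ltac:(lra)) as Hz.
    set (z := sqrt (ypar t)) in *. clearbody z. rewrite <- Hz. field. lra.
Qed.

Lemma is_derive_wpar t : is_derive wpar t (arc_density t * vpar t).
Proof.
  unfold wpar. pose proof (xipar_pos t) as Hx. pose proof (is_derive_xipar t) as Hd.
  pose proof (ypar_pos t) as Hy. pose proof (kpar_pos t) as Hk. pose proof sqrt3_pos.
  pose proof (sqrt_lt_R0 _ Hy) as Hs.
  evar_last; [apply is_derive_inv; [exact Hd | lra]|].
  unfold arc_density, vpar. rewrite (pow32_sqr (ypar t) Hy : xipar t ^ 2 = _).
  unfold xipar. pose proof (sqrt_sqrt (ypar t) ltac:(lra)) as Hz.
  set (z := sqrt (ypar t)) in *. clearbody z. rewrite <- Hz. field. repeat split; lra.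
Qed.

Lemma is_derive_kpar t :
  is_derive kpar t ((2 * ypar t + lin q) * (yamp * cos t) / (2 * kpar t)).
Proof.
  unfold kpar. pose proof (is_derive_ypar t) as Hd.
  apply (is_derive_sqrt (fun t => cofactor (lin q) (cst q) (ypar t))).
  - unfold cofactor. auto_derive; [repeat split; eexists; exact Hd|].
    change (Derive (fun x => ypar x) t) with (Derive ypar t).
    rewrite (is_derive_unique _ _ _ Hd). ring.
  - apply cofactor_pos, ypar_pos.
Qed.

(** After clearing denominators this is the identity [3 T - y T' = y^4 - 9] for the quartic,
    where the derivative [T'] is expanded by the product rule along the factorization. *)
Lemma is_derive_vpar t : is_derive vpar t (arc_density t * apar t).
Proof.
  unfold vpar. pose proof (xipar_pos t) as Hx. pose proof (is_derive_xipar t) as Hdx.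
  pose proof (is_derive_kpar t) as Hdk.
  pose proof (ypar_pos t) as Hy. pose proof (kpar_pos t) as Hk. pose proof sqrt3_pos as H3.
  pose proof (sqrt_lt_R0 _ Hy) as Hs. pose proof (sqrt_sqrt 3 ltac:(lra)) as H33.
  auto_derive.
  - repeat split; try (eexists; eassumption).
    apply Rgt_not_eq, Rmult_lt_0_compat; lra.
  - change (Derive (fun x => xipar x) t) with (Derive xipar t).
    change (Derive (fun x => kpar x) t) with (Derive kpar t).
    rewrite (is_derive_unique _ _ _ Hdx), (is_derive_unique _ _ _ Hdk).
    pose proof (quartic_factor_derive C q (ypar t)) as HD.
    pose proof (quartic_ypar t) as HQ. pose proof (kpar_sqr t) as Hkk.
    assert (HN : (yamp * cos t) ^ 2 = (ypar t - ymin q) * (ymax q - ypar t)).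
    { pose proof (sin2_cos2 t) as H. unfold Rsqr in H.
      replace ((yamp * cos t) ^ 2) with (yamp ^ 2 * (cos t * cos t)) by ring.
      replace (cos t * cos t) with (1 - sin t * sin t) by lra.
      unfold ypar, ymid, yamp. field. }
    assert (HS : ymin q + ymax q - 2 * ypar t = - 2 * (yamp * sin t))
      by (unfold ypar, ymid; field).
    rewrite <- HN, <- Hkk, HS in HD. unfold quartic in HQ.
    rewrite Rpow_mult_distr in HQ.
    unfold arc_density, apar. replace (3 * sqrt 3 / 2) with (9 / (2 * sqrt 3)) by (replace 9 with (3 * (sqrt 3 * sqrt 3)) by lra; field; lra).
    set (N := (yamp * cos t) ^ 2) in *.
    (* The numerator is [3 T - y T'], with [T = N k^2] and [N' = - 2 (yamp * sin t)]. *)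
    transitivity ((2 * ypar t * (yamp * sin t) * kpar t ^ 2 - ypar t * N * (2 * ypar t + lin q)
       + 3 * N * kpar t ^ 2) / (2 * sqrt 3 * ypar t * xipar t * kpar t)).
    + unfold N, xipar. set (z := sqrt (ypar t)) in *. field. repeat split; lra.
    + replace (2 * ypar t * (yamp * sin t) * kpar t ^ 2 - ypar t * N * (2 * ypar t + lin q)
       + 3 * N * kpar t ^ 2) with (ypar t ^ 4 - 9).
      * field. repeat split; lra.
      * transitivity (- ypar t * (-4 * ypar t ^ 3 + 9 * C * ypar t ^ 2) + 3 * (- ypar t ^ 4 + 3 * C * ypar t ^ 3 - 3)).
        ring. rewrite HQ, HD. ring.
Qed.

End Profile.

Arguments ypar {C}. Arguments xipar {C}. Arguments kpar {C}. Arguments arc_density {C}.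
Arguments phase {C}. Arguments yamp {C}. Arguments wpar {C}. Arguments vpar {C}. Arguments apar {C}.

(** * Half periods of the parameter *)

(** Even half periods are described by a translation and odd ones by a reflection, so that the
    sine of the parameter is unchanged ([sin_branch]). *)
Definition branch (k : Z) (t : R) : R :=
  if Z.even k then IZR k * PI + t else IZR k * PI - t.

Lemma even_double k : Z.even k = true -> exists j, k = (2 * j)%Z.
Proof. intros H. apply Z.even_spec in H. exact H. Qed.

Lemma odd_double k : Z.even k = false -> exists j, k = (2 * j + 1)%Z.
Proof. intros H. rewrite <- Z.negb_odd in H. apply Z.odd_spec. now destruct (Z.odd k). Qed.

Lemma sin_branch k t : sin (branch k t) = sin t.
Proof.
  unfold branch. destruct (Z.even k) eqn:E.
  - destruct (even_double k E) as [j ->]. rewrite mult_IZR.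
    rewrite <- (sin_period_Z t j). f_equal. ring.
  - destruct (odd_double k E) as [j ->]. rewrite plus_IZR, mult_IZR.
    rewrite <- (sin_PI_x t), <- (sin_period_Z (PI - t) j). f_equal. ring.
Qed.

(** Rounding [t / PI] to the nearest integer; the minus signs place ties on the right end. *)
Lemma half_turn_index t : exists k, IZR k * PI - PI / 2 < t <= IZR k * PI + PI / 2.
Proof.
  pose proof PI_RGT_0 as HP.
  exists (- up (- (t / PI) - / 2))%Z.
  destruct (archimed (- (t / PI) - / 2)) as [A B]. rewrite opp_IZR.
  set (n := IZR (up (- (t / PI) - / 2))) in *.
  set (u := t / PI) in *. replace t with (u * PI) by (unfold u; field; lra).
  split; nra.
Qed.

Lemma in_branch k t : IZR k * PI - PI / 2 < t < IZR k * PI + PI / 2 ->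
  exists s, - (PI / 2) < s < PI / 2 /\ t = branch k s.
Proof.
  intros Ht. unfold branch. destruct (Z.even k).
  - exists (t - IZR k * PI). split; lra.
  - exists (IZR k * PI - t). split; lra.
Qed.

Lemma branch_bounds k s : - (PI / 2) < s < PI / 2 ->
  IZR k * PI - PI / 2 < branch k s < IZR k * PI + PI / 2.
Proof. intros Hs. unfold branch. destruct (Z.even k); lra. Qed.

Lemma cos_branch k s : - (PI / 2) < s < PI / 2 -> cos (branch k s) <> 0.
Proof.
  intros Hs E. pose proof (sin2_cos2 (branch k s)) as H1. pose proof (sin2_cos2 s) as H2.
  rewrite sin_branch, E in H1. unfold Rsqr in *. pose proof (cos_gt_0 s). nra.
Qed.

(** * The height and the function F *)

Section Height.

Variables (C : R) (q : quartic_factorization C) (Cs : R).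
Hypothesis HC : C_crit < C.
Hypothesis HCs : Cs_range C Cs.

Lemma Cs_pos : 0 < Cs.
Proof. apply HCs. Qed.

Lemma Cs_sqr_lt : Cs ^ 2 * (C - C_crit) < 1.
Proof.
  destruct HCs as [H0 H1]. fold C_crit in H1.
  assert (Hd : 0 < C - C_crit) by lra. set (d := C - C_crit) in *.
  replace (- (1 / 2)) with (- / 2) in H1 by lra.
  rewrite Rpower_Ropp, Rpower_sqrt in H1 by auto.
  pose proof (sqrt_lt_R0 d Hd) as Hs. pose proof (sqrt_sqrt d ltac:(lra)) as Hss.
  assert (Cs * sqrt d < 1).
  { apply Rmult_lt_reg_r with (/ sqrt d); [now apply Rinv_0_lt_compat|].
    rewrite Rmult_assoc, Rinv_r by lra. lra. }
  replace (Cs ^ 2 * d) with ((Cs * sqrt d) * (Cs * sqrt d)).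
  - assert (0 < Cs * sqrt d) by nra. nra.
  - rewrite <- Hss at 3. ring.
Qed.

(** The squared derivative of the height with respect to arc length: the profile curve has
    distance [Cs * w] to the axis and unit speed, so that this is [1 - (Cs dw/ds)^2]. *)
Definition defect (y : R) : R := 1 - Cs ^ 2 * quartic C y / (3 * y ^ 3).

(** This is where the upper bound on [Cs] enters: the lower bound is positive by [Cs_sqr_lt]. *)
Lemma defect_ge y : 0 < y -> 1 - Cs ^ 2 * (C - C_crit) <= defect y.
Proof.
  intros Hy. unfold defect. pose proof (quartic_le C y Hy) as H.
  assert (H3 : 0 < 3 * y ^ 3) by (pose proof (pow_lt y 3 Hy); lra).
  assert (quartic C y / (3 * y ^ 3) <= C - C_crit).
  { apply Rmult_le_reg_r with (3 * y ^ 3); auto.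
    unfold Rdiv. rewrite Rmult_assoc, Rinv_l by lra. lra. }
  pose proof (pow2_ge_0 Cs) as Hc.
  unfold Rdiv in *. rewrite Rmult_assoc.
  apply (Rmult_le_compat_l _ _ _ Hc) in H0. lra.
Qed.

Lemma defect_pos y : 0 < y -> 0 < defect y.
Proof. intros Hy. pose proof (defect_ge y Hy). pose proof Cs_sqr_lt. lra. Qed.

Definition dpar (t : R) : R := defect (ypar q t).
Definition dens (t : R) : R := arc_density q t * sqrt (dpar t).

Lemma dpar_pos t : 0 < dpar t.
Proof. apply defect_pos, ypar_pos. Qed.

Lemma dpar_le_1 t : dpar t <= 1.
Proof.
  unfold dpar, defect. rewrite quartic_ypar.
  assert (0 <= Cs ^ 2 * (yamp q * cos t * kpar q t) ^ 2 / (3 * ypar q t ^ 3)); [|lra].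
  apply Rmult_le_pos; [apply Rmult_le_pos; apply pow2_ge_0|].
  left. apply Rinv_0_lt_compat. pose proof (pow_lt _ 3 (ypar_pos C q t)). lra.
Qed.

Lemma Ck_dpar n : Ck n line dpar.
Proof.
  unfold dpar, defect, quartic.
  apply Ck_minus; auto using open_line, Ck_const.
  apply Ck_div; auto using open_line.
  - intros t _. pose proof (pow_lt _ 3 (ypar_pos C q t)). lra.
  - apply Ck_mult; auto using open_line, Ck_const.
    apply Ck_minus; auto using open_line, Ck_const.
    apply Ck_plus; auto using open_line.
    + apply Ck_opp; auto using open_line. apply Ck_pow; auto using open_line, Ck_ypar.
    + apply Ck_mult; auto using open_line, Ck_const.
      apply Ck_pow; auto using open_line, Ck_ypar.
  - apply Ck_mult; auto using open_line, Ck_const.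
    apply Ck_pow; auto using open_line, Ck_ypar.
Qed.

Lemma Ck_sqrt_dpar n : Ck n line (fun t => sqrt (dpar t)).
Proof. apply Ck_sqrt_comp; auto using open_line, Ck_dpar. intros; apply dpar_pos. Qed.

Lemma Ck_dens n : Ck n line dens.
Proof. apply Ck_mult; auto using open_line, Ck_arc_density, Ck_sqrt_dpar. Qed.

Lemma dens_continuous t : continuous dens t.
Proof. apply (Ck_continuous 0 line); [apply Ck_dens | exact I]. Qed.

Lemma dens_lower : exists k, 0 < k /\ forall t, k <= dens t.
Proof.
  destruct (arc_density_lower C q) as [k [Hk H]].
  set (d := 1 - Cs ^ 2 * (C - C_crit)).
  assert (Hd : 0 < d) by (pose proof Cs_sqr_lt; unfold d; lra).
  exists (k * sqrt d). split.
  - apply Rmult_lt_0_compat; auto. now apply sqrt_lt_R0.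
  - intros t. apply Rmult_le_compat; auto; try lra. apply sqrt_pos.
    apply sqrt_le_1_alt. apply defect_ge, ypar_pos.
Qed.

Lemma dens_pos t : 0 < dens t.
Proof. destruct dens_lower as [k [Hk H]]. specialize (H t). lra. Qed.

Lemma dens_eq s t : sin s = sin t -> dens s = dens t.
Proof. intros H. unfold dens, arc_density, dpar, kpar, ypar. now rewrite H. Qed.

(** It vanishes at the parameter of [xi00], as [h0] does. *)
Definition height (t : R) : R := RInt dens (phase q (xi00 C)) t.

Lemma is_derive_height t : is_derive height t (dens t).
Proof.
  apply (is_derive_RInt dens height (phase q (xi00 C))).
  - apply filter_forall. intros s. apply (RInt_correct dens).
    apply (@ex_RInt_continuous R_CompleteNormedModule). intros; apply dens_continuous.
  - apply dens_continuous.
Qed.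

Lemma height_lt s t : s < t -> height s < height t.
Proof. apply (strictly_increasing_of_derive height dens is_derive_height dens_pos). Qed.

Lemma height_inj s t : height s = height t -> s = t.
Proof.
  intros H. destruct (Rtotal_order s t) as [K|[K|K]]; auto; apply height_lt in K; lra.
Qed.

Lemma Ck_height n : Ck (S n) line height.
Proof. apply Ck_S with dens; auto using open_line, is_derive_height, Ck_dens. Qed.

Definition height_bot : R := height (- (PI / 2)).
Definition height_top : R := height (PI / 2).

(** A reflection of the parameter about a turning point leaves [sin], hence [dens], invariant. *)
Lemma height_reflect c t : sin c = 1 \/ sin c = -1 -> height (2 * c - t) + height t = 2 * height c.
Proof.
  intros Hc.
  assert (Hcos : cos c = 0).
  { pose proof (sin2_cos2 c) as H. unfold Rsqr in H.
    assert (cos c * cos c = 0) by (destruct Hc as [E|E]; rewrite E in H; lra). nra. }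
  assert (Hs : forall s, sin (2 * c - s) = sin s).
  { intros s. rewrite sin_minus, sin_2a, cos_2a, Hcos.
    destruct Hc as [E|E]; rewrite E; ring. }
  rewrite (derive_zero_const (fun s => height (2 * c - s) + height s) t c).
  - replace (2 * c - c) with c by ring. ring.
  - intros s _. replace 0 with (-1 * dens (2 * c - s) + dens s).
    + apply @is_derive_plus; [|apply is_derive_height].
      apply (is_derive_comp height (fun s => 2 * c - s)); [apply is_derive_height|].
      auto_derive; auto; ring.
    + rewrite (dens_eq _ _ (Hs s)). ring.
Qed.

Lemma height_reflect_top t : height (PI - t) = 2 * height_top - height t.
Proof.
  pose proof (height_reflect (PI / 2) t (or_introl sin_PI2)) as H.
  replace (2 * (PI / 2)) with PI in H by field. unfold height_top. lra.
Qed.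

Lemma height_reflect_bot t : height (- PI - t) = 2 * height_bot - height t.
Proof.
  pose proof (height_reflect (- (PI / 2)) t) as H.
  replace (2 * - (PI / 2)) with (- PI) in H by field. unfold height_bot.
  rewrite sin_neg, sin_PI2 in H. specialize (H (or_intror eq_refl)). lra.
Qed.

(** A translation by a full period is the composition of the two reflections. *)
Lemma height_period t k : height (t + 2 * IZR k * PI) = height t + 2 * IZR k * (height_top - height_bot).
Proof.
  assert (S1 : forall t, height (t + 2 * PI) = height t + 2 * (height_top - height_bot)).
  { intros s. replace (s + 2 * PI) with (PI - (- PI - s)) by ring.
    rewrite height_reflect_top, height_reflect_bot. ring. }
  assert (Sn : forall n t, height (t + 2 * INR n * PI) = height t + 2 * INR n * (height_top - height_bot)).
  { induction n as [|n IH]; intros s.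
    - replace (s + 2 * INR 0 * PI) with s by (simpl; ring). simpl. ring.
    - rewrite S_INR. replace (s + 2 * (INR n + 1) * PI) with (s + 2 * INR n * PI + 2 * PI) by ring.
      rewrite S1, IH. ring. }
  destruct (IZR_nat_or_opp k) as [n [E|E]]; rewrite E; auto.
  pose proof (Sn n (t + 2 * - INR n * PI)) as H.
  replace (t + 2 * - INR n * PI + 2 * INR n * PI) with t in H by ring. lra.
Qed.

(** The substitution [tau = xipar u] in the integral that defines [h0]; on the principal interval
    [cos] is positive, and the singularity of the integrand at the end points cancels against
    the zeros of the derivative of [xipar]. *)
Lemma h0_xipar t : - (PI / 2) < t < PI / 2 -> h0 C Cs (xipar q t) = height t.
Proof.
  intros Ht. destruct (xipar_phase_start C q) as [E Hs]. unfold height, h0.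
  rewrite <- E at 1.
  set (s := phase q (xi00 C)) in *.
  set (f := fun tau => sqrt ((3 * tau ^ 2 - Cs ^ 2 * T C tau) / (tau ^ 4 * T C tau))).
  set (dx := fun u => 3 / 2 * sqrt (ypar q u) * (yamp q * cos u)).
  assert (Hin : forall u, Rmin s t <= u <= Rmax s t -> - (PI / 2) < u < PI / 2).
  { intros u [H1 H2]. split.
    - apply Rlt_le_trans with (2 := H1). apply Rmin_glb_lt; tauto.
    - apply Rle_lt_trans with (1 := H2). apply Rmax_lub_lt; tauto. }
  rewrite <- (RInt_comp f (xipar q) dx s t).
  - apply RInt_ext. intros u Hu.
    assert (Hc : 0 < cos u).
    { destruct (Hin u) as [A B]; [lra|]. now apply cos_gt_0. }
    pose proof (ypar_pos C q u) as Hy. pose proof (kpar_pos C q u) as Hk.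
    pose proof (yamp_pos C q) as Hr. pose proof (sqrt_lt_R0 _ Hy) as Hz.
    pose proof (dpar_pos u) as Hd. pose proof sqrt3_pos as H3.
    assert (Hf : f (xipar q u) = sqrt 3 * sqrt (dpar u) /
       (ypar q u * sqrt (ypar q u) * (yamp q * cos u * kpar q u))).
    { assert (H0 : 0 < yamp q * cos u * kpar q u) by (apply Rmult_lt_0_compat; [apply Rmult_lt_0_compat|]; auto).
      unfold f. apply sqrt_lem_1.
      - left. pose proof (xipar_pos C q u).
        unfold xipar in *. rewrite T_pow32, pow32_sqr, quartic_ypar by auto.
        unfold dpar, defect in Hd. rewrite quartic_ypar in Hd.
        apply Rdiv_lt_0_compat.
        + apply Rmult_lt_reg_r with (/ (3 * ypar q u ^ 3)).
          * apply Rinv_0_lt_compat. pose proof (pow_lt _ 3 Hy). lra.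
          * eapply Rle_lt_trans; [right; apply Rmult_0_l|].
            eapply Rlt_le_trans; [exact Hd|]. right. field. lra.
        + apply Rmult_lt_0_compat; apply pow_lt; auto.
      - left. apply Rdiv_lt_0_compat; [|now apply Rmult_lt_0_compat; [apply pow32_pos|]].
        apply Rmult_lt_0_compat; auto. now apply sqrt_lt_R0.
      - unfold xipar. rewrite T_pow32 by auto.
        replace ((ypar q u * sqrt (ypar q u)) ^ 4) with (((ypar q u * sqrt (ypar q u)) ^ 2) ^ 2) by ring.
        rewrite pow32_sqr by auto. rewrite quartic_ypar.
        pose proof (sqrt_sqrt 3 ltac:(lra)) as H33.
        pose proof (sqrt_sqrt (dpar u) ltac:(lra)) as Hdd.
        pose proof (sqrt_sqrt (ypar q u) ltac:(lra)) as Hyy.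
        set (Y := yamp q * cos u * kpar q u) in *.
        transitivity ((sqrt 3 * sqrt 3) * (sqrt (dpar u) * sqrt (dpar u)) /
          (ypar q u ^ 2 * (sqrt (ypar q u) * sqrt (ypar q u)) * Y ^ 2)).
        + field. repeat split; lra.
        + rewrite H33, Hdd, Hyy. unfold dpar, defect. rewrite quartic_ypar. fold Y.
          field. repeat split; lra. }
    rewrite Hf. unfold scal; simpl. unfold mult; simpl. unfold dx, dens, arc_density.
    field. repeat split; lra.
  - intros u Hu. pose proof (Hin u Hu) as Hu'.
    pose proof (xipar_pos C q u) as Hx.
    assert (HT : 0 < T C (xipar q u)).
    { unfold xipar. rewrite T_pow32, quartic_ypar by apply ypar_pos. apply pow_lt.
      apply Rmult_lt_0_compat; [apply Rmult_lt_0_compat|];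
        [apply yamp_pos | apply cos_gt_0; lra | apply kpar_pos]. }
    assert (CT : continuous (T C) (xipar q u)).
    { apply @ex_derive_continuous. unfold T.
      apply @ex_derive_minus; [|apply ex_derive_const].
      apply @ex_derive_plus; [|auto_derive; auto].
      apply @ex_derive_opp. eexists. apply is_derive_Reals. now apply derivable_pt_lim_power. }
    assert (Cp : forall n, continuous (fun x : R => x ^ n) (xipar q u)).
    { intros n. apply @ex_derive_continuous. auto_derive; auto. }
    apply continuous_sqrt_comp. apply continuous_Rdiv.
    + apply @continuous_minus; apply @continuous_mult; auto; apply continuous_const.
    + apply @continuous_mult; auto.
    + apply Rgt_not_eq, Rmult_lt_0_compat; auto. now apply pow_lt.
  - intros u Hu. split; [apply is_derive_xipar|].
    apply @continuous_mult.
    + apply @continuous_mult; [apply continuous_const|].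
      apply (Ck_continuous 0 line (fun u => sqrt (ypar q u))); [apply Ck_sqrt_ypar|exact I].
    + apply @continuous_mult; [apply continuous_const|apply continuous_cos].
Qed.

Lemma height_continuous t : continuous height t.
Proof. apply @ex_derive_continuous. eexists; apply is_derive_height. Qed.

Lemma phase_lt x t : xi01 C < x < xi02 C -> - (PI / 2) <= t <= PI / 2 ->
  x < xipar q t -> phase q x < t.
Proof.
  intros Hx Ht Hlt. pose proof (phase_range C q x Hx) as Hp. apply Rnot_le_lt. intros H.
  rewrite <- (xipar_phase C q x Hx) in Hlt. destruct H as [H|H].
  - apply Rlt_asym in Hlt. apply Hlt, xipar_lt, sin_increasing_1; lra.
  - rewrite H in Hlt. lra.
Qed.

Lemma phase_gt x t : xi01 C < x < xi02 C -> - (PI / 2) <= t <= PI / 2 ->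
  xipar q t < x -> t < phase q x.
Proof.
  intros Hx Ht Hlt. pose proof (phase_range C q x Hx) as Hp. apply Rnot_le_lt. intros H.
  rewrite <- (xipar_phase C q x Hx) in Hlt. destruct H as [H|H].
  - apply Rlt_asym in Hlt. apply Hlt, xipar_lt, sin_increasing_1; lra.
  - rewrite H in Hlt. lra.
Qed.

Lemma h0_phase x : xi01 C < x < xi02 C -> h0 C Cs x = height (phase q x).
Proof.
  intros Hx. rewrite <- (xipar_phase C q x Hx) at 1. apply h0_xipar. now apply phase_range.
Qed.

(** The formula [h0_phase] shows convergence of the improper integral and gives its value. *)
Lemma h0_m1_eq : h0_m1 C Cs = height_bot.
Proof.
  assert (L : filterlim (h0 C Cs) (at_right (xi01 C)) (locally height_bot)).
  { apply filterlim_locally. intros eps.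
    destruct (proj1 (filterlim_locally _ _) (height_continuous (- (PI / 2))) eps) as [del Hdel].
    pose proof PI_RGT_0 as HP.
    set (d := Rmin (del / 2) (PI / 2)).
    assert (Hd : 0 < d) by (apply Rmin_glb_lt; [|lra]; pose proof (cond_pos del); lra).
    assert (Hd1 : d <= del / 2) by apply Rmin_l. assert (Hd2 : d <= PI / 2) by apply Rmin_r.
    destruct (xipar_range C q (- (PI / 2) + d) ltac:(lra)) as [K1 K2].
    apply (locally_open (fun u => u < xipar q (- (PI / 2) + d))); [apply open_lt| |exact K1].
    intros u Hu Hu1. rewrite h0_phase by lra. apply Hdel.
    change (Rabs (phase q u - - (PI / 2)) < del).
    pose proof (phase_range C q u ltac:(lra)).
    pose proof (phase_lt u (- (PI / 2) + d) ltac:(lra) ltac:(lra) Hu).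
    rewrite Rabs_right by lra. pose proof (cond_pos del). lra. }
  unfold h0_m1. apply (iota_unique (V := R_CompleteNormedModule)); auto.
  intros y Hy.
  apply (filterlim_locally_unique (F := at_right (xi01 C)) (V := R_NormedModule) (h0 C Cs)); auto.
Qed.

Lemma h0_1_eq : h0_1 C Cs = height_top.
Proof.
  assert (L : filterlim (h0 C Cs) (at_left (xi02 C)) (locally height_top)).
  { apply filterlim_locally. intros eps.
    destruct (proj1 (filterlim_locally _ _) (height_continuous (PI / 2)) eps) as [del Hdel].
    pose proof PI_RGT_0 as HP.
    set (d := Rmin (del / 2) (PI / 2)).
    assert (Hd : 0 < d) by (apply Rmin_glb_lt; [|lra]; pose proof (cond_pos del); lra).
    assert (Hd1 : d <= del / 2) by apply Rmin_l. assert (Hd2 : d <= PI / 2) by apply Rmin_r.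
    destruct (xipar_range C q (PI / 2 - d) ltac:(lra)) as [K1 K2].
    apply (locally_open (fun u => xipar q (PI / 2 - d) < u)); [apply open_gt| |exact K2].
    intros u Hu Hu1. rewrite h0_phase by lra. apply Hdel.
    change (Rabs (phase q u - PI / 2) < del).
    pose proof (phase_range C q u ltac:(lra)).
    pose proof (phase_gt u (PI / 2 - d) ltac:(lra) ltac:(lra) Hu).
    rewrite Rabs_left by lra. pose proof (cond_pos del). lra. }
  unfold h0_1. apply (iota_unique (V := R_CompleteNormedModule)); auto.
  intros y Hy.
  apply (filterlim_locally_unique (F := at_left (xi02 C)) (V := R_NormedModule) (h0 C Cs)); auto.
Qed.

Lemma h_k_height k x : xi01 C < x < xi02 C ->
  h_k C Cs k x = height (branch k (phase q x)).
Proof.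
  intros Hx. unfold h_k, branch. rewrite h0_1_eq, h0_m1_eq, h0_phase by auto.
  destruct (Z.even k) eqn:E.
  - destruct (even_double k E) as [j ->]. rewrite mult_IZR.
    replace (2 * IZR j * PI + phase q x) with (phase q x + 2 * IZR j * PI) by ring.
    rewrite height_period. ring.
  - destruct (odd_double k E) as [j ->]. rewrite plus_IZR, mult_IZR.
    replace ((2 * IZR j + 1) * PI - phase q x) with (PI - phase q x + 2 * IZR j * PI) by ring.
    rewrite height_period, height_reflect_top. ring.
Qed.

(** The parameter of the break point [h_{0,k}]. The shift changes sign with [k] because the
    numbering of the break points skips 0. *)
Definition turn (k : Z) : R := if (1 <=? k)%Z then (IZR k - / 2) * PI else (IZR k + / 2) * PI.

Lemma h0_k_height k : h0_k C Cs k = height (turn k) /\ F_end C k = xipar q (turn k).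
Proof.
  assert (Htop : forall j, height (2 * IZR j * PI + PI / 2) = height_top + 2 * IZR j * (height_top - height_bot) /\
                           xi02 C = xipar q (2 * IZR j * PI + PI / 2)).
  { intros j. split.
    - rewrite Rplus_comm, height_period. reflexivity.
    - rewrite <- (xipar_top C q). apply xipar_eq. now rewrite Rplus_comm, sin_period_Z. }
  assert (Hbot : forall j, height (2 * IZR j * PI - PI / 2) = height_bot + 2 * IZR j * (height_top - height_bot) /\
                           xi01 C = xipar q (2 * IZR j * PI - PI / 2)).
  { intros j. split.
    - unfold Rminus at 1. rewrite Rplus_comm, height_period. reflexivity.
    - rewrite <- (xipar_bot C q). apply xipar_eq. unfold Rminus. now rewrite Rplus_comm, sin_period_Z. }
  unfold h0_k, F_end, turn. rewrite h0_1_eq, h0_m1_eq, <- Z.negb_even.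
  destruct (1 <=? k)%Z; destruct (Z.even k) eqn:E; simpl negb; cbv iota.
  - destruct (even_double k E) as [j ->]. rewrite mult_IZR.
    replace ((2 * IZR j - / 2) * PI) with (2 * IZR j * PI - PI / 2) by field.
    destruct (Hbot j) as [-> ->]. split; [ring|reflexivity].
  - destruct (odd_double k E) as [j ->]. rewrite plus_IZR, mult_IZR.
    replace ((2 * IZR j + 1 - / 2) * PI) with (2 * IZR j * PI + PI / 2) by field.
    destruct (Htop j) as [-> ->]. split; [ring|reflexivity].
  - destruct (even_double k E) as [j ->]. rewrite mult_IZR.
    replace ((2 * IZR j + / 2) * PI) with (2 * IZR j * PI + PI / 2) by field.
    destruct (Htop j) as [-> ->]. split; [ring|reflexivity].
  - destruct (odd_double k E) as [j ->]. rewrite plus_IZR, mult_IZR.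
    replace ((2 * IZR j + 1 + / 2) * PI) with (2 * IZR (j + 1) * PI - PI / 2) by (rewrite plus_IZR; field).
    destruct (Hbot (j + 1)%Z) as [-> ->]. rewrite plus_IZR. split; [ring|reflexivity].
Qed.

(** Each parameter is either in an open half period, and then in the range of some [h_k], or at
    the right end of one, and then at a break point. *)
Lemma F_graph_height t : F_graph C Cs (height t) (xipar q t).
Proof.
  destruct (half_turn_index t) as [k [H1 [H2|H2]]].
  - left. exists k. destruct (in_branch k t (conj H1 H2)) as [s [Hs ->]].
    rewrite (xipar_eq C q _ s) by apply sin_branch.
    split; [now apply xipar_range|].
    rewrite h_k_height by (now apply xipar_range). rewrite phase_xipar by lra. reflexivity.
  - right. exists (if (0 <=? k)%Z then k + 1 else k)%Z.
    destruct (Z.leb_spec 0 k) as [Hk|Hk].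
    + destruct (h0_k_height (k + 1)) as [-> ->].
      replace (turn (k + 1)) with t; [split; [lia|split; reflexivity]|].
      unfold turn. destruct (Z.leb_spec 1 (k + 1)); [|lia]. rewrite plus_IZR. lra.
    + destruct (h0_k_height k) as [-> ->].
      replace (turn k) with t; [split; [lia|split; reflexivity]|].
      unfold turn. destruct (Z.leb_spec 1 k); [lia|]. lra.
Qed.

(** As [height] is injective, all branches and break points over the same height share the
    parameter [t], of which the value is a function. *)
Lemma F_graph_unique t x : F_graph C Cs (height t) x -> x = xipar q t.
Proof.
  intros [[k [Hx H]]|[k [_ [H1 H2]]]].
  - rewrite h_k_height in H by auto. apply height_inj in H. subst t.
    rewrite (xipar_eq C q _ (phase q x)) by apply sin_branch. now rewrite xipar_phase.
  - destruct (h0_k_height k) as [E1 E2]. rewrite E1 in H1. apply height_inj in H1.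
    rewrite H1, H2. exact E2.
Qed.

(** This disposes of the integral, the limits and the case distinctions in the definition of [F]:
    from here on, only the smooth functions [height] and [xipar] matter. *)
Lemma F_height t : F C Cs (height t) = xipar q t.
Proof.
  apply (iota_unique (V := R_CompleteNormedModule)).
  - apply F_graph_unique.
  - apply F_graph_height.
Qed.

End Height.

(** * Isometries preserving the second coordinate *)

Lemma diff_fst f p u : diff (fun q => f (fst q)) p u = Derive f (fst p) * fst u.
Proof.
  unfold diff, sum_axes. rewrite partial_fst_ax1, partial_fst_ax2. cbn [coord]. ring.
Qed.

Lemma diff_snd_id p u : diff (fun q => snd q) p u = snd u.
Proof.
  unfold diff, sum_axes, partial. cbn [along coord snd fst].
  rewrite Derive_const, Derive_id. ring.
Qed.

(** A change of the first coordinate alone has a diagonal differential, so that the isometry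
    condition splits into one equation for each coefficient. *)
Lemma isometric_rotational (DA DB : R -> Prop) E G E' G' (al be : R -> R) :
  (forall x, DA x -> DB (al x) /\ be (al x) = x) ->
  (forall y, DB y -> DA (be y) /\ al (be y) = y) ->
  Ck 3 DA al -> Ck 3 DB be ->
  (forall x, DA x -> E' (al x) * Derive al x ^ 2 = E x) ->
  (forall x, DA x -> G' (al x) = G x) ->
  isometric (fun p => DA (fst p)) (rotational_metric E G) (fun p => DB (fst p)) (rotational_metric E' G').
Proof.
  intros HA HB CA CB HE HG.
  exists (fun p => (al (fst p), snd p)), (fun p => (be (fst p), snd p)).
  assert (K : forall (D : R -> Prop) f, Ck 3 D f ->
    class_C_map 3 (fun p => D (fst p)) (fun p => (f (fst p), snd p))).
  { intros D f Hf i. destruct i.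
    - apply (class_C_fst 3 D f Hf).
    - apply (class_C_snd 3 D (fun t => t)). apply Ck_id, open_line. }
  split; [|split; [|split; [|split]]]; auto.
  - intros p Hp. destruct (HA _ Hp) as [H1 H2]. split; auto.
    apply injective_projections; auto.
  - intros p Hp. destruct (HB _ Hp) as [H1 H2]. split; auto.
    apply injective_projections; auto.
  - intros p u v Hp. unfold diff_map. cbn [fst snd]. rewrite !(diff_fst al), !diff_snd_id.
    unfold rotational_metric, diag_metric. cbn [fst snd]. rewrite HG, <- HE by auto. ring.
Qed.

(** * The metric in terms of the height *)

Lemma Ck_phase C (q : quartic_factorization C) n : Ck n (fun x => xi01 C < x < xi02 C) (phase q).
Proof.
  assert (O : open (fun x => xi01 C < x < xi02 C)) by apply open_between.
  apply (Ck_comp n _ unit_ball asin (fun x => (Rpower x (2 / 3) - ymid C q) / yamp q));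
    auto using Ck_asin.
  - intros x Hx. now apply phase_arg.
  - apply Ck_mult; auto using Ck_const. apply Ck_minus; auto using Ck_const.
    apply Ck_subset with positive_reals; [|apply Ck_Rpower].
    intros x Hx. unfold positive_reals. rewrite (xi01_eq C q) in Hx.
    pose proof (pow32_pos _ (ymin_pos q)). lra.
Qed.

(** The energy relation [(dw/ds)^2 = T / (3 xi^2)]. *)
Lemma vpar_sqr C (q : quartic_factorization C) t :
  vpar q t ^ 2 = quartic C (ypar q t) / (3 * ypar q t ^ 3).
Proof.
  pose proof (ypar_pos C q t) as Hy. pose proof (xipar_pos C q t) as Hx.
  pose proof sqrt3_pos as H3. pose proof (sqrt_sqrt 3 ltac:(lra)) as H33.
  rewrite <- (pow32_sqr (ypar q t)) by auto. fold (xipar q t). unfold vpar. rewrite quartic_ypar.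
  rewrite <- H33 at 2. field. split; lra.
Qed.

Lemma profile_by_height C (q : quartic_factorization C) Cs : C_crit < C -> Cs_range C Cs ->
  exists Phi, (forall h, height C q Cs (Phi h) = h) /\ (forall t, Phi (height C q Cs t) = t) /\
    (forall h, is_derive Phi h (/ dens C q Cs (Phi h))).
Proof.
  intros HC HCs. destruct (dens_lower C q Cs HC HCs) as [k [Hk H]].
  apply (global_inverse (height C q Cs) (dens C q Cs) k Hk); auto.
  intros t. now apply is_derive_height.
Qed.

Section Surface.

Variables (C : R) (q : quartic_factorization C) (Cs : R).
Hypothesis HC : C_crit < C.
Hypothesis HCs : Cs_range C Cs.
Variable Phi : R -> R.
Hypothesis height_Phi : forall h, height C q Cs (Phi h) = h.
Hypothesis Phi_height : forall t, Phi (height C q Cs t) = t.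
Hypothesis is_derive_Phi : forall h, is_derive Phi h (/ dens C q Cs (Phi h)).

Lemma F_Phi h : F C Cs h = xipar q (Phi h).
Proof. rewrite <- (height_Phi h) at 1. now apply F_height. Qed.

(** The derivative of the inverse is [/ dens] composed with the inverse itself, which gains
    one order of differentiability at each step. *)
Lemma Ck_Phi n : Ck n line Phi.
Proof.
  induction n as [|n IH].
  - intros h _. apply @ex_derive_continuous. eexists; apply is_derive_Phi.
  - apply Ck_S with (fun h => / dens C q Cs (Phi h)); auto using open_line.
    apply (Ck_comp n line line (fun t => / dens C q Cs t) Phi); auto using open_line.
    apply Ck_inv; auto using open_line, Ck_dens. intros; now apply dens_pos.
Qed.

Lemma Ck_comp_Phi n f : Ck n line f -> Ck n line (fun h => f (Phi h)).
Proof. intros Hf. apply (Ck_comp n line line f Phi); auto using open_line, Ck_Phi. Qed.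

Definition E_coef (h : R) : R := / dpar C q Cs (Phi h).
Definition G_coef (h : R) : R := wpar q (Phi h) ^ 2.
(** The square root of [E_coef], that is, [ds/dh]. *)
Definition root_E (h : R) : R := / sqrt (dpar C q Cs (Phi h)).

Lemma wpar_pos t : 0 < wpar q t.
Proof. apply Rinv_0_lt_compat, xipar_pos. Qed.

Lemma sqrt_dpar_pos t : 0 < sqrt (dpar C q Cs t).
Proof. apply sqrt_lt_R0. now apply dpar_pos. Qed.

Lemma E_coef_pos h : 0 < E_coef h.
Proof. apply Rinv_0_lt_compat. now apply dpar_pos. Qed.

Lemma G_coef_pos h : 0 < G_coef h.
Proof. apply pow_lt, wpar_pos. Qed.

Lemma Ck_wpar n : Ck n line (wpar q).
Proof. apply Ck_inv; auto using open_line, Ck_xipar. intros; apply xipar_pos. Qed.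

Lemma Ck_E_coef n : Ck n line E_coef.
Proof.
  apply (Ck_comp_Phi n (fun t => / dpar C q Cs t)). apply Ck_inv; auto using open_line, Ck_dpar.
  intros; now apply dpar_pos.
Qed.

Lemma Ck_G_coef n : Ck n line G_coef.
Proof.
  apply (Ck_comp_Phi n (fun t => wpar q t ^ 2)). apply Ck_pow; auto using open_line, Ck_wpar.
Qed.

Lemma Ck_root_E n : Ck n line root_E.
Proof.
  apply (Ck_comp_Phi n (fun t => / sqrt (dpar C q Cs t))).
  apply Ck_inv; auto using open_line, Ck_sqrt_dpar. intros; apply sqrt_dpar_pos.
Qed.

Lemma root_E_sqr h : E_coef h = root_E h ^ 2.
Proof.
  unfold E_coef, root_E. rewrite pow_inv, pow2_sqrt; auto. left; now apply dpar_pos.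
Qed.

Lemma g_CCs_rotational : g_CCs C Cs = rotational_metric E_coef G_coef.
Proof.
  unfold g_CCs, rotational_metric. f_equal; extensionality p; rewrite F_Phi.
  - pose proof (ypar_pos C q (Phi (fst p))) as Hy.
    pose proof (dpar_pos C q Cs HC HCs (Phi (fst p))) as Hd.
    unfold E_coef, dpar, defect in *. unfold xipar. rewrite T_pow32, pow32_sqr by auto.
    set (y := ypar q (Phi (fst p))) in *. pose proof (pow_lt y 3 Hy).
    assert (0 < 3 * y ^ 3 - Cs ^ 2 * quartic C y).
    { replace (3 * y ^ 3 - Cs ^ 2 * quartic C y)
        with ((1 - Cs ^ 2 * quartic C y / (3 * y ^ 3)) * (3 * y ^ 3)) by (field; lra).
      apply Rmult_lt_0_compat; lra. }
    field. repeat split; lra.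
  - unfold G_coef, wpar. pose proof (xipar_pos C q (Phi (fst p))). field. lra.
Qed.

(** Converts a derivative with respect to arc length into one with respect to the height. *)
Lemma is_derive_comp_Phi f f' h :
  (forall t, is_derive f t (arc_density q t * f' t)) ->
  is_derive (fun h => f (Phi h)) h (root_E h * f' (Phi h)).
Proof.
  intros Hf. evar_last; [apply (is_derive_comp f Phi); [apply Hf | apply is_derive_Phi]|].
  unfold scal; simpl; unfold mult; simpl. unfold dens, root_E.
  pose proof (sqrt_dpar_pos (Phi h)). pose proof (arc_density_pos C q (Phi h)).
  field. split; lra.
Qed.

Lemma riemannian : riemannian_metric plane (g_CCs C Cs).
Proof.
  rewrite g_CCs_rotational. apply riemannian_metric_rotational; auto using E_coef_pos, G_coef_pos, Ck_E_coef, Ck_G_coef.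
Qed.

(** The value is [1 - F^(8/3) / 9], since [y = F^(2/3)]. *)
Lemma curvature : gauss_curvature (g_CCs C Cs) = fun p => 1 - ypar q (Phi (fst p)) ^ 4 / 9.
Proof.
  rewrite g_CCs_rotational.
  rewrite (gauss_curvature_rotational E_coef G_coef root_E (fun h => wpar q (Phi h))
    (fun h => vpar q (Phi h)) (fun h => apar q (Phi h))).
  - extensionality p. unfold apar, wpar. pose proof (xipar_pos C q (Phi (fst p))). field. lra.
  - apply root_E_sqr.
  - reflexivity.
  - intros. apply Rinv_0_lt_compat, sqrt_dpar_pos.
  - intros. apply wpar_pos.
  - intros h. apply (Ck_root_E 1). exact I.
  - intros h. apply (is_derive_comp_Phi (wpar q) (vpar q)). intros; apply is_derive_wpar.
  - intros h. apply (is_derive_comp_Phi (vpar q) (apar q)). intros; apply is_derive_vpar.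
Qed.

Lemma curvature_lt_1 p : 1 - gauss_curvature (g_CCs C Cs) p > 0.
Proof.
  rewrite curvature. pose proof (pow_lt _ 4 (ypar_pos C q (Phi (fst p)))). lra.
Qed.

Lemma complete : complete_metric plane (g_CCs C Cs).
Proof.
  rewrite g_CCs_rotational.
  set (X1 := ymin q * sqrt (ymin q)). set (X2 := ymax q * sqrt (ymax q)).
  pose proof (ymin_pos q) as Hy1. pose proof (ymin_lt_ymax C q) as Hy2.
  assert (HX1 : 0 < X1) by now apply pow32_pos.
  assert (HX2 : 0 < X2) by (apply pow32_pos; lra).
  set (d := 1 - Cs ^ 2 * (C - C_crit)).
  assert (Hd : 0 < d) by (pose proof (Cs_sqr_lt C Cs HC HCs); unfold d; lra).
  assert (HE : forall h, 1 <= E_coef h <= / d).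
  { intros h. pose proof (dpar_pos C q Cs HC HCs (Phi h)). split.
    - rewrite <- Rinv_1. apply Rinv_le_contravar; auto. now apply dpar_le_1.
    - apply Rinv_le_contravar; auto. apply defect_ge. apply ypar_pos. }
  assert (HG : forall h, (/ X2) ^ 2 <= G_coef h <= (/ X1) ^ 2).
  { intros h. pose proof (ypar_bounds C q (Phi h)) as Hy.
    assert (Hx : X1 <= xipar q (Phi h) <= X2).
    { unfold X1, X2, xipar. split; apply Rmult_le_compat; try lra; try apply sqrt_pos;
        apply sqrt_le_1_alt; lra. }
    pose proof (xipar_pos C q (Phi h)).
    pose proof (Rinv_0_lt_compat X1 HX1). pose proof (Rinv_0_lt_compat X2 HX2).
    unfold G_coef, wpar. split; apply pow_incr; split; try (left; apply wpar_pos); try lra;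
      apply Rinv_le_contravar; lra. }
  assert (H2 : 0 < (/ X2) ^ 2) by (apply pow_lt, Rinv_0_lt_compat; auto).
  apply (complete_rotational E_coef G_coef (Rmin 1 ((/ X2) ^ 2)) (Rmax (/ d) ((/ X1) ^ 2))).
  - apply Rmin_glb_lt; lra.
  - intros h. specialize (HE h). split.
    + apply Rle_trans with 1; [apply Rmin_l | lra].
    + apply Rle_trans with (/ d); [lra | apply Rmax_l].
  - intros h. specialize (HG h). split.
    + apply Rle_trans with ((/ X2) ^ 2); [apply Rmin_r | lra].
    + apply Rle_trans with ((/ X1) ^ 2); [lra | apply Rmax_r].
  - intros h. apply (Ck_continuous 0 line); [apply Ck_E_coef | exact I].
  - intros h. apply (Ck_continuous 0 line); [apply Ck_G_coef | exact I].
Qed.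

Definition radius (h : R) : R := Cs * wpar q (Phi h).

Lemma Psi_revolve : Psi C Cs = revolve radius Cs.
Proof.
  extensionality p. unfold Psi, revolve, radius, wpar. now rewrite F_Phi.
Qed.

Lemma Ck_radius n : Ck n line radius.
Proof.
  apply Ck_mult; auto using open_line, Ck_const. apply Ck_comp_Phi, Ck_wpar.
Qed.

Lemma universal_cover :
  riemannian_universal_cover (g_CCs C Cs) (Psi C Cs) (Psi_surface C Cs).
Proof.
  pose proof (Cs_pos C Cs HCs) as H0.
  split; [apply riemannian|]. split; [apply simply_connected_plane|].
  unfold Psi_surface. rewrite Psi_revolve. split; [|split].
  - apply covering_revolve; auto.
    + intros h. apply Rmult_lt_0_compat; auto. apply wpar_pos.
    + intros h. apply (Ck_continuous 0 line); [apply Ck_radius | exact I].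
  - apply class_C_map3_revolve, Ck_radius.
  - intros p u v. rewrite induced_metric_revolve, g_CCs_rotational; auto.
    2:{ intros h. apply (Ck_radius 1). exact I. }
    unfold rotational_metric, diag_metric. f_equal; f_equal.
    + assert (HD : Derive radius (fst p) = Cs * (root_E (fst p) * vpar q (Phi (fst p)))).
      { unfold radius. rewrite Derive_scal. f_equal. apply is_derive_unique.
        apply (is_derive_comp_Phi (wpar q) (vpar q)). intros; apply is_derive_wpar. }
      rewrite HD, !Rpow_mult_distr, <- root_E_sqr, vpar_sqr.
      pose proof (ypar_pos C q (Phi (fst p))) as Hy.
      pose proof (dpar_pos C q Cs HC HCs (Phi (fst p))) as Hd.
      assert (HA : Cs ^ 2 * (quartic C (ypar q (Phi (fst p))) / (3 * ypar q (Phi (fst p)) ^ 3))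
                   = 1 - dpar C q Cs (Phi (fst p)))
        by (unfold dpar, defect, Rdiv; ring).
      unfold E_coef.
      transitivity (1 + / dpar C q Cs (Phi (fst p)) * (1 - dpar C q Cs (Phi (fst p))));
        [rewrite <- HA; ring | field; lra].
    + unfold G_coef, radius. f_equal. field. lra.
Qed.

(** The preimage of the open half periods: the points where the derivative of [F] is not zero. *)
Definition moving : R * R -> Prop := fun p =>
  exists k, IZR k * PI - PI / 2 < Phi (fst p) < IZR k * PI + PI / 2.

Lemma Phi_continuous h : continuous Phi h.
Proof. apply (Ck_continuous 0 line); [apply Ck_Phi | exact I]. Qed.

Lemma open_strip k :
  open (fun p : R * R => IZR k * PI - PI / 2 < Phi (fst p) < IZR k * PI + PI / 2).
Proof.
  apply (open_comp (fun p : R * R => Phi (fst p))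
    (fun t => IZR k * PI - PI / 2 < t < IZR k * PI + PI / 2)); [|apply open_between].
  intros [h t] _. apply (continuous_comp fst Phi); [apply continuous_fst | apply Phi_continuous].
Qed.

Lemma moving_open : open moving.
Proof.
  intros p [k Hk]. apply (locally_open _ moving (open_strip k)); auto.
  intros q' Hq'. now exists k.
Qed.

(** Just after the end of a half period [Phi], being increasing and continuous, lies in the next one. *)
Lemma moving_dense : dense moving.
Proof.
  intros A OA [[h th] Hp]. pose proof PI_RGT_0 as HP.
  destruct (half_turn_index (Phi h)) as [k [H1 [H2|H2]]].
  - exists (h, th). split; auto. exists k. simpl. lra.
  - destruct (OA _ Hp) as [e1 He1].
    destruct (proj1 (filterlim_locally _ _) (Phi_continuous h) (mkposreal _ HP)) as [e2 He2].
    set (d := Rmin e1 e2 / 2).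
    assert (Hm : 0 < Rmin e1 e2) by (apply Rmin_glb_lt; apply cond_pos).
    assert (Hm1 := Rmin_l e1 e2). assert (Hm2 := Rmin_r e1 e2).
    assert (B : forall e : posreal, Rmin e1 e2 <= e -> ball h e (h + d)).
    { intros e He. change (Rabs (h + d - h) < e). replace (h + d - h) with d by ring.
      rewrite Rabs_right; unfold d; lra. }
    exists (h + d, th). split.
    + apply He1. split; [apply B; auto | apply ball_center].
    + exists (k + 1)%Z. cbn [fst]. rewrite plus_IZR.
      pose proof (He2 (h + d) (B e2 Hm2)) as H3.
      change (Rabs (Phi (h + d) - Phi h) < PI) in H3. apply Rabs_def2 in H3.
      assert (Phi h < Phi (h + d)).
      { apply (strictly_increasing_of_derive Phi _ is_derive_Phi).
        - intros x. apply Rinv_0_lt_compat. now apply dens_pos.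
        - unfold d; lra. }
      lra.
Qed.

Lemma moving_cos p : moving p -> cos (Phi (fst p)) <> 0.
Proof.
  intros [k Hk]. destruct (in_branch k _ Hk) as [s [Hs ->]]. now apply cos_branch.
Qed.

Lemma gradient_nonzero p : moving p ->
  gradient (g_CCs C Cs) (gauss_curvature (g_CCs C Cs)) p <> (0, 0).
Proof.
  intros Hp E. apply moving_cos in Hp. apply (f_equal fst) in E. cbn [fst] in E.
  rewrite curvature, g_CCs_rotational in E.
  rewrite (gradient_rotational E_coef G_coef (fun h => 1 - ypar q (Phi h) ^ 4 / 9)) in E
    by (apply E_coef_pos || apply G_coef_pos).
  set (h := fst p) in *.
  assert (HD : Derive (fun h => 1 - ypar q (Phi h) ^ 4 / 9) h =
    - 4 * ypar q (Phi h) ^ 3 * (yamp q * cos (Phi h) * / dens C q Cs (Phi h)) / 9).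
  { apply is_derive_unique. assert (D : is_derive (fun h => ypar q (Phi h)) h (yamp q * cos (Phi h) * / dens C q Cs (Phi h))).
    { evar_last; [apply (is_derive_comp (ypar q) Phi); [apply is_derive_ypar | apply is_derive_Phi]|].
      unfold scal; simpl; unfold mult; simpl. ring. }
    assert (K : forall Y d, is_derive Y h d ->
      is_derive (fun h => 1 - Y h ^ 4 / 9) h (- 4 * Y h ^ 3 * d / 9)).
    { intros Y d HY. auto_derive; [eexists; exact HY|].
      change (Derive (fun x => Y x) h) with (Derive Y h).
      rewrite (is_derive_unique _ _ _ HY). field. }
    now apply (K (fun h => ypar q (Phi h))). }
  rewrite HD in E. unfold Rdiv in E.
  pose proof (E_coef_pos h). pose proof (pow_lt _ 3 (ypar_pos C q (Phi h))).
  pose proof (yamp_pos C q). pose proof (dens_pos C q Cs HC HCs (Phi h)) as Hd.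
  apply Rinv_0_lt_compat in Hd. apply Rinv_0_lt_compat in H.
  apply Rmult_integral in E. destruct E as [E|E]; [|lra].
  apply Rmult_integral in E. destruct E as [E|E]; [|lra].
  apply Rmult_integral in E. destruct E as [E|E]; [lra|].
  apply Rmult_integral in E. destruct E as [E|E]; [|lra].
  apply Rmult_integral in E. destruct E as [E|E]; lra.
Qed.

(** On a half period [xipar] is injective with image the whole interval between the two roots,
    and its inverse is [branch k] of [phase]. *)
Lemma local_isometry : locally_isometric moving (g_CCs C Cs) (D_C C) (g_C C).
Proof.
  intros p [k Hk].
  exists (fun p => IZR k * PI - PI / 2 < Phi (fst p) < IZR k * PI + PI / 2), (D_C C).
  split; [apply open_strip|]. split; [exact Hk|].
  split; [intros p' Hp'; now exists k|].
  split.
  { apply (open_comp (fun p : R * R => fst p) (fun x => xi01 C < x < xi02 C)); [|apply open_between].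
    intros [h t] _. apply continuous_fst. }
  split; [auto|].
  rewrite g_CCs_rotational.
  assert (OI : open (fun x => xi01 C < x < xi02 C)) by apply open_between.
  apply (isometric_rotational (fun h => IZR k * PI - PI / 2 < Phi h < IZR k * PI + PI / 2)
    (fun x => xi01 C < x < xi02 C) E_coef G_coef
    (fun x => 3 / (x ^ 2 * T C x)) (fun x => 1 / x ^ 2)
    (fun h => xipar q (Phi h)) (fun x => height C q Cs (branch k (phase q x)))).
  - intros h Hh. destruct (in_branch k _ Hh) as [s [Hs Es]].
    rewrite (xipar_eq C q (Phi h) s) by (rewrite Es; apply sin_branch).
    split; [now apply xipar_range|]. rewrite phase_xipar by lra. rewrite <- Es. apply height_Phi.
  - intros x Hx. rewrite Phi_height. split.
    + now apply branch_bounds, phase_range.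
    + rewrite (xipar_eq C q _ (phase q x)) by apply sin_branch. now apply xipar_phase.
  - apply Ck_subset with line; [intros; exact I|]. apply Ck_comp_Phi, Ck_xipar.
  - apply (Ck_comp 3 _ line (height C q Cs) (fun x => branch k (phase q x))); auto.
    + intros; exact I.
    + now apply Ck_height.
    + unfold branch. destruct (Z.even k).
      * apply Ck_plus; auto using Ck_const, Ck_phase.
      * apply Ck_minus; auto using Ck_const, Ck_phase.
  - intros h Hh. destruct (in_branch k _ Hh) as [s [Hs Es]].
    assert (Hcos : cos (Phi h) <> 0) by (rewrite Es; now apply cos_branch).
    pose proof (yamp_pos C q) as Hr. pose proof (kpar_pos C q (Phi h)) as Hkp.
    pose proof (ypar_pos C q (Phi h)) as Hy. pose proof (xipar_pos C q (Phi h)) as Hx.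
    pose proof (sqrt_lt_R0 _ Hy) as Hz. pose proof sqrt3_pos as H3.
    pose proof (sqrt_dpar_pos (Phi h)) as Hsd.
    pose proof (dpar_pos C q Cs HC HCs (Phi h)) as Hd.
    assert (HD : Derive (fun h => xipar q (Phi h)) h =
      xipar q (Phi h) * (yamp q * cos (Phi h) * kpar q (Phi h)) / (sqrt 3 * sqrt (dpar C q Cs (Phi h)))).
    { apply is_derive_unique. evar_last.
      - apply (is_derive_comp (xipar q) Phi); [apply is_derive_xipar | apply is_derive_Phi].
      - unfold scal; simpl; unfold mult; simpl. unfold dens, arc_density, xipar.
        field. repeat split; lra. }
    rewrite HD. unfold xipar at 2. rewrite T_pow32, quartic_ypar by auto.
    pose proof (sqrt_sqrt 3 ltac:(lra)) as H33. pose proof (sqrt_sqrt (dpar C q Cs (Phi h)) ltac:(lra)) as Hdd.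
    unfold E_coef.
    transitivity (3 / (sqrt 3 * sqrt 3) / (sqrt (dpar C q Cs (Phi h)) * sqrt (dpar C q Cs (Phi h)))).
    + field. repeat split; lra.
    + rewrite H33, Hdd. field. lra.
  - intros h Hh. unfold G_coef, wpar. pose proof (xipar_pos C q (Phi h)). field. lra.
Qed.

End Surface.

(** Both surfaces have the same arc length and the same [w] as functions of the parameter, so that
    passing from one height to the other at equal parameter is an isometry. *)
Lemma isometric_planes C (q : quartic_factorization C) Cs1 Cs2 :
  C_crit < C -> Cs_range C Cs1 -> Cs_range C Cs2 ->
  isometric plane (g_CCs C Cs1) plane (g_CCs C Cs2).
Proof.
  intros HC H1 H2.
  destruct (profile_by_height C q Cs1 HC H1) as [Phi1 [A1 [B1 D1]]].
  destruct (profile_by_height C q Cs2 HC H2) as [Phi2 [A2 [B2 D2]]].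
  rewrite (g_CCs_rotational C q Cs1 HC H1 Phi1 A1), (g_CCs_rotational C q Cs2 HC H2 Phi2 A2).
  apply (isometric_rotational line line _ _ _ _ (fun h => height C q Cs2 (Phi1 h))
           (fun h => height C q Cs1 (Phi2 h))).
  - intros h _. split; [exact I|]. now rewrite B2.
  - intros h _. split; [exact I|]. now rewrite B1.
  - apply (Ck_comp_Phi C q Cs1 HC H1 Phi1 D1). now apply Ck_height.
  - apply (Ck_comp_Phi C q Cs2 HC H2 Phi2 D2). now apply Ck_height.
  - intros h _. unfold E_coef. rewrite B2. set (t := Phi1 h).
    assert (HD : Derive (fun h => height C q Cs2 (Phi1 h)) h =
       sqrt (dpar C q Cs2 t) / sqrt (dpar C q Cs1 t)).
    { apply is_derive_unique. evar_last.
      - apply (is_derive_comp (height C q Cs2) Phi1); [now apply is_derive_height | apply D1].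
      - unfold scal; simpl; unfold mult; simpl. fold t. unfold dens.
        pose proof (sqrt_dpar_pos C q Cs1 HC H1 t). pose proof (arc_density_pos C q t).
        field. split; lra. }
    rewrite HD. pose proof (dpar_pos C q Cs1 HC H1 t). pose proof (dpar_pos C q Cs2 HC H2 t).
    unfold Rdiv. rewrite Rpow_mult_distr, pow_inv, !pow2_sqrt by lra. field. lra.
  - intros h _. unfold G_coef. now rewrite B2.
Qed.

(** * The proposition *)

Theorem proposition4p17 :
  forall C : R, 4 / Rpower 3 (3 / 2) < C ->
    (forall Cs : R, Cs_range C Cs ->
       riemannian_universal_cover (g_CCs C Cs) (Psi C Cs) (Psi_surface C Cs) /\
       complete_metric plane (g_CCs C Cs) /\
       (forall p : R * R, 1 - gauss_curvature (g_CCs C Cs) p > 0) /\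
       (exists U : R * R -> Prop,
          open U /\ dense U /\
          locally_isometric U (g_CCs C Cs) (D_C C) (g_C C) /\
          (forall p, U p ->
             gradient (g_CCs C Cs) (gauss_curvature (g_CCs C Cs)) p <> (0, 0)))) /\
    (forall Cs1 Cs2 : R, Cs_range C Cs1 -> Cs_range C Cs2 ->
       isometric plane (g_CCs C Cs1) plane (g_CCs C Cs2)).
Proof.
  intros C HC. destruct (quartic_factorization_exists C HC) as [q]. split.
  - intros Cs HCs.
    destruct (profile_by_height C q Cs HC HCs) as [Phi [A [B D]]].
    split; [now apply (universal_cover C q Cs HC HCs Phi)|].
    split; [now apply (complete C q Cs HC HCs Phi)|].
    split; [now apply (curvature_lt_1 C q Cs HC HCs Phi)|].
    exists (moving Phi). split; [|split; [|split]].
    + now apply (moving_open C q Cs HC HCs Phi).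
    + now apply (moving_dense C q Cs HC HCs Phi).
    + now apply (local_isometry C q Cs HC HCs Phi).
    + now apply (gradient_nonzero C q Cs HC HCs Phi).
  - intros Cs1 Cs2. now apply (isometric_planes C q).
Qed.
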